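(* Let $f\in L_2(\Omega)$ and $\psi\in H^{1/2}(\Gamma_N)$. Let $u\in\mathcal V_{0,D}$ be a solution of $$(\kappa(x,u)\nabla u,\nabla v)=(f,v)+\int_{\Gamma_N}\psi v\quad\text{for all } v\in\mathcal V_{0,D}.$$ Suppose that for every triangle $T\in\mathcal T$, with vertices $a_1,a_2,a_3$, $$\gamma_T^{-1}(1+\gamma_T^{-1})\max_{i',j'\in\{1,2,3\}}|u(a_{i'})-u(a_{j'})|<\frac{6k_\alpha c_T}{7L_0}.$$ Then $u$ is the unique solution in $\mathcal V_{0,D}$ of this discrete problem.
   Context: $\Omega\subset\mathbb R^2$ is an open bounded polygonal domain with boundary $\partial\Omega=\Gamma_D\cup\Gamma_N$, where $\Gamma_D$ has positive measure and $\Gamma_N=\partial\Omega\setminus\Gamma_D$. $\mathcal T$ is a conforming triangulation of $\Omega$ by triangles that exactly captures $\partial\Omega$ and each of $\Gamma_D$ and $\Gamma_N$. Mesh regularity: there are numbers $0<t_{\min}<t_{\max}$ such that the interior angles $\theta_1,\theta_2,\theta_3$ of every $T\in\mathcal T$ satisfy $t_{\min}\le\theta_i\le t_{\max}<\pi/2$, $i=1,2,3$. For $T\in\mathcal T$ with interior angles $\theta_1,\theta_2,\theta_3$ set $$\gamma_T=\min_{i,j\in\{1,2,3\}}\frac{\sin\theta_i}{\sin\theta_j},\qquad c_T=\min_{i=1,2,3}\cos\theta_i .$$ $\mathcal V_{0,D}$ is the space of continuous functions on $\overline\Omega$ that are affine on each $T\in\mathcal T$ and vanish on $\Gamma_D$.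 $(\cdot,\cdot)$ is the $L_2(\Omega)$ inner product (of scalar or vector functions). The coefficient $\kappa:\Omega\times\mathbb R\to\mathbb R$ is a Carathéodory function (measurable in $x$ for each $s$, continuous in $s$ for a.e. $x$). There are constants $0<k_\alpha<k_\beta$ with $k_\alpha<\kappa(x,s)<k_\beta$ for all $s\in\mathbb R$ and a.e. $x\in\Omega$, and a constant $L_0>0$ with $|\kappa(x,s)-\kappa(x,t)|\le L_0|s-t|$ for all $s,t\in\mathbb R$ and a.e. $x\in\Omega$. The discrete equation is the finite element weak form of $-\mathrm{div}(\kappa(x,u)\nabla u)=f$ in $\Omega$ with $u=0$ on $\Gamma_D$ and $\kappa(x,u)\nabla u^T\boldsymbol n=\psi$ on $\Gamma_N$, where $\boldsymbol n$ is the outward normal. *)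

(* Defs.v *)
From HB Require Import structures.
From mathcomp Require Import all_boot all_order all_algebra.
From mathcomp Require Import all_classical all_reals all_analysis.
From mathcomp Require Import measurable_realfun.

Set Implicit Arguments.
Unset Strict Implicit.
Unset Printing Implicit Defensive.

Import Order.TTheory GRing.Theory Num.Theory.
Import numFieldNormedType.Exports.

Local Open Scope classical_set_scope.
Local Open Scope ring_scope.

(** Euclidean geometry of the plane. The norm that the library puts on [R * R]
    is the max norm, so Euclidean lengths and angles go through [dot]. *)

Definition dot (R : realType) (x y : R * R) : R := x.1 * y.1 + x.2 * y.2.

Definition enorm (R : realType) (x : R * R) : R := Num.sqrt (dot x x).

Definition angle (R : realType) (p q r : R * R) : R :=
  acos (dot (q - p) (r - p) / (enorm (q - p) * enorm (r - p))).

Definition seg_path (R : realType) (p q : R * R) (t : R) : R * R :=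
  p + t *: (q - p).

Definition segment (R : realType) (p q : R * R) : set (R * R) :=
  seg_path p q @` `[0, 1].

Definition open_segment (R : realType) (p q : R * R) : set (R * R) :=
  seg_path p q @` `]0, 1[.

Definition frontier (R : realType) (A : set (R * R)) : set (R * R) :=
  closure A `\` A°.

Definition polygonal_domain (R : realType) (Omega : set (R * R)) : Prop :=
  [/\ open Omega, connected Omega, Omega !=set0, bounded_set Omega &
      exists s : seq ((R * R) * (R * R)),
        frontier Omega = \bigcup_(pq in [set` s]) segment pq.1 pq.2].

(** Interior angles of the triangle [a] and the quantities gamma_T and c_T. The
    neutral element 1 of the two minima changes nothing: the ratio is 1 for
    [i = j], and cosines are at most 1. *)

Definition interior_angle (R : realType) (a : 'I_3 -> R * R) (i : 'I_3) : R :=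
  angle (a i) (a (i + 1)) (a (i + 2)).

Definition gammaT (R : realType) (a : 'I_3 -> R * R) : R :=
  \big[Num.min/1]_(i < 3) \big[Num.min/1]_(j < 3)
    (sin (interior_angle a i) / sin (interior_angle a j)).

Definition cT (R : realType) (a : 'I_3 -> R * R) : R :=
  \big[Num.min/1]_(i < 3) cos (interior_angle a i).

Definition oscT (R : realType) (a : 'I_3 -> R * R) (u : R * R -> R) : R :=
  \big[Num.max/0]_(i < 3) \big[Num.max/0]_(j < 3) `|u (a i) - u (a j)|.

(** A mesh is a finite family of points together with a finite set of triangles,
    each given by the indices of its three vertices. *)

Record mesh (R : realType) := Mesh {
  nnodes : nat;
  node : 'I_nnodes -> R * R;
  cells : {set {ffun 'I_3 -> 'I_nnodes}} }.

Arguments node {R} m _.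
Arguments cells {R} m.

Section mesh.
Context {R : realType} (M : mesh R).
Implicit Types (T : {ffun 'I_3 -> 'I_(nnodes M)}).

Definition vertices T : 'I_3 -> R * R := fun i => node M (T i).

Definition hull (s : {set 'I_(nnodes M)}) : set (R * R) :=
  [set x | exists w : 'I_(nnodes M) -> R,
    [/\ forall i, 0 <= w i, \sum_(i in s) w i = 1 &
        x = \sum_(i in s) w i *: node M i]].

Definition vertex_set T : {set 'I_(nnodes M)} := [set T i | i : 'I_3].

Definition triangle T : set (R * R) := hull (vertex_set T).

Definition nondegenerate T : Prop :=
  let a := vertices T in
  ((a 1).1 - (a 0).1) * ((a 2%:R).2 - (a 0).2)
    != ((a 1).2 - (a 0).2) * ((a 2%:R).1 - (a 0).1).

(** Edges are ordered by node index, so that an edge shared by two triangles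
    occurs only once. *)
Definition edges : {set 'I_(nnodes M) * 'I_(nnodes M)} :=
  [set e : 'I_(nnodes M) * 'I_(nnodes M) | (e.1 < e.2)%N &
    [exists T in cells M, (e.1 \in vertex_set T) && (e.2 \in vertex_set T)]].

Definition boundary_edges (Omega : set (R * R)) :
    {set 'I_(nnodes M) * 'I_(nnodes M)} :=
  [set e in edges |
    `[< segment (node M e.1) (node M e.2) `<=` frontier Omega >]].

(** Two distinct triangles meet in nothing, in a common vertex or in a common
    edge, that is in the hull of their (at most two) common vertices. The
    boundary is a union of mesh edges, and each boundary edge, up to its end
    points, lies either in [GammaD] or in its complement. *)
Definition conforming_triangulation (Omega GammaD : set (R * R)) : Prop :=
  [/\ injective (node M) /\ (forall T, T \in cells M -> nondegenerate T),
      forall T T', T \in cells M -> T' \in cells M -> T <> T' ->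
        (#|vertex_set T :&: vertex_set T'| <= 2)%N /\
        triangle T `&` triangle T' = hull (vertex_set T :&: vertex_set T'),
      closure Omega = \bigcup_(T in [set` cells M]) triangle T,
      frontier Omega =
        \bigcup_(e in [set` boundary_edges Omega])
          segment (node M e.1) (node M e.2) &
      forall e, e \in boundary_edges Omega ->
        open_segment (node M e.1) (node M e.2) `<=` GammaD \/
        open_segment (node M e.1) (node M e.2) `<=` ~` GammaD].

Definition affine_on (A : set (R * R)) (v : R * R -> R) : Prop :=
  exists (c : R) (g : R * R), forall x, A x -> v x = c + dot g x.

Definition V0D (Omega GammaD : set (R * R)) : set (R * R -> R) :=
  [set v | [/\ {within closure Omega, continuous v},
               forall T, T \in cells M -> affine_on (triangle T) v &
               forall x, GammaD x -> v x = 0]].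

End mesh.

(** Arc length on the part of the boundary of [Omega] made of mesh edges, as a
    measure on the plane; [measurableTypeR R] is [R] as the carrier of
    [lebesgue_measure]. *)

Section arc_length.
Context {R : realType}.
Local Open Scope ereal_scope.

Lemma measurable_seg_path (p q : R * R) :
  measurable_fun [set: measurableTypeR R]
    (seg_path p q : measurableTypeR R -> measurableTypeR R * measurableTypeR R).
Proof.
apply/measurable_fun_pairP; split.
- apply: (continuous_measurable_fun (f := fun t : R => (p.1 + t * (q - p).1)%R)).
  by move=> t; apply: cvgD; [exact: cvg_cst|apply: cvgMl; exact: cvg_id].
- apply: (continuous_measurable_fun (f := fun t : R => (p.2 + t * (q - p).2)%R)).
  by move=> t; apply: cvgD; [exact: cvg_cst|apply: cvgMl; exact: cvg_id].
Qed.

Definition arc_length (M : mesh R) (Omega : set (R * R))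
    (A : set (measurableTypeR R * measurableTypeR R)) : \bar R :=
  \sum_(e in boundary_edges M Omega)
    (enorm (node M e.2 - node M e.1)%R)%:E *
    lebesgue_measure
      (seg_path (node M e.1) (node M e.2) @^-1` A `&` `[0%R, 1%R]).

Context (M : mesh R) (Omega : set (R * R)).

Let arc_length0 : arc_length M Omega set0 = 0.
Proof.
by rewrite /arc_length big1// => e _; rewrite preimage_set0 set0I measure0 mule0.
Qed.

Let arc_length_ge0 A : 0 <= arc_length M Omega A.
Proof.
by apply: sume_ge0 => e _; rewrite mule_ge0// lee_fin /enorm Num.Theory.sqrtr_ge0.
Qed.

Let arc_length_sigma_additive : semi_sigma_additive (arc_length M Omega).
Proof.
move=> F mF tF mUF.
rewrite [X in _ --> X](_ : _ =
    lim ((fun n => \sum_(0 <= i < n) arc_length M Omega (F i)) @ \oo)).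
  by apply: is_cvg_ereal_nneg_natsum => k _; exact: arc_length_ge0.
rewrite nneseries_sum//; last first.
  by move=> *; rewrite mule_ge0// lee_fin /enorm Num.Theory.sqrtr_ge0.
apply: eq_bigr => /= e _.
have mP A : measurable A -> measurable
    (seg_path (node M e.1) (node M e.2) @^-1` A `&` `[0%R, 1%R]
      : set (measurableTypeR R)).
  move=> mA; apply: measurableI; last exact: measurable_itv.
  by rewrite -[X in measurable X]setTI; exact: measurable_seg_path.
rewrite nneseriesZl//; congr (_ * _).
rewrite preimage_bigcup setI_bigcupl measure_semi_bigcup//.
- move=> k; apply: (mP _ (mF k)).
- apply/trivIsetP => i j _ _ ij; rewrite setIACA setIid -preimage_setI.
  by move/trivIsetP : tF => /(_ _ _ _ _ ij) ->//; rewrite preimage_set0 set0I.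
- by rewrite -setI_bigcupl -preimage_bigcup; exact: mP.
Qed.

HB.instance Definition _ := isMeasure.Build _ _ _ (arc_length M Omega)
  arc_length0 arc_length_ge0 arc_length_sigma_additive.

End arc_length.


Definition lebesgue2 (R : realType) :
    {measure set (measurableTypeR R * measurableTypeR R) -> \bar R} :=
  (@lebesgue_measure R \x @lebesgue_measure R)%E.

(** Measurability with respect to the completion of [mu]. The integral of the
    library is defined for every function, and for an [f] that is measurable in
    this sense it is the integral of any measurable [g] equal to [f] almost
    everywhere. *)
Definition ae_measurable d (T : measurableType d) (R : realType)
    (mu : {measure set T -> \bar R}) (D : set T) (f : T -> R) : Prop :=
  exists2 g : T -> R, measurable_fun D g & {ae mu, forall x, D x -> f x = g x}.

Definition square_integrable d (T : measurableType d) (R : realType)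
    (mu : {measure set T -> \bar R}) (D : set T) (f : T -> R) : Prop :=
  ae_measurable mu D f /\ (\int[mu]_(x in D) (f x ^+ 2)%:E < +oo)%E.

(** Membership in H^(1/2) of a part [G] of the boundary: finite
    Sobolev-Slobodeckij norm, where |x - y| has exponent d + 2s with d = 1 and
    s = 1/2. The diagonal, where the quotient is 0 by convention, is null. *)
Definition H_half (R : realType) (M : mesh R) (Omega G : set (R * R))
    (psi : R * R -> R) : Prop :=
  square_integrable (arc_length M Omega) G psi /\
  (\int[arc_length M Omega]_(x in G) \int[arc_length M Omega]_(y in G)
     ((psi x - psi y) ^+ 2 / enorm (x - y) ^+ 2)%:E < +oo)%E.

Definition grad (R : realType) (v : R * R -> R) (x : R * R) : R * R :=
  ('D_(1, 0) v x, 'D_(0, 1) v x).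

Definition caratheodory_fun (R : realType) (Omega : set (R * R))
    (kappa : R * R -> R -> R) : Prop :=
  (forall s, ae_measurable (lebesgue2 R) Omega (fun x => kappa x s)) /\
  {ae lebesgue2 R, forall x, Omega x -> continuous (kappa x)}.

Definition discrete_solution (R : realType) (M : mesh R)
    (Omega GammaD : set (R * R)) (kappa : R * R -> R -> R)
    (f psi u : R * R -> R) : Prop :=
  V0D M Omega GammaD u /\
  forall v, V0D M Omega GammaD v ->
    \int[lebesgue2 R]_(x in Omega) (kappa x (u x) * dot (grad u x) (grad v x)) =
    \int[lebesgue2 R]_(x in Omega) (f x * v x) +
    \int[arc_length M Omega]_(x in frontier Omega `\` GammaD) (psi x * v x).

(* Main.v *)
Require Import Defs.
From mathcomp Require Import all_boot all_order all_algebra.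
From mathcomp Require Import all_classical all_reals all_analysis.
From mathcomp Require Import measurable_realfun.
From mathcomp Require Import ring lra.

(** Let [w] be another solution and let [t] be a sign. The difference of the two
    equations is tested with the piecewise affine [v] that is 1 at the nodes
    where [t * (w - u) > 0] and 0 at the others. On a triangle where [v] is not
    constant, one vertex [p] has a nodal sign opposite to that of [q] and [r];
    by the cotangent formula for the inner products of gradients
    [t * grad (w - u) . grad v] is then a positive combination of the differences
    [|e p - e q|] and [|e p - e r|] of [e = w - u], with weights bounded below
    through the angles, and their sum dominates [|e|] on the triangle. By the law
    of sines and the smallness of [u] the term with [kappa (w) - kappa (u)] is
    strictly smaller, so [t * (kappa (w) grad w - kappa (u) grad u) . grad v] is
    positive on such a triangle. It is 0 on the other triangles, and its integral
    is 0: [v] is constant on each triangle. As [Omega] is connected and [v]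
    vanishes on [GammaD], [v = 0]. *)

Import Order.TTheory GRing.Theory Num.Theory.
Import numFieldNormedType.Exports.

Local Open Scope classical_set_scope.
Local Open Scope ring_scope.

(** * Euclidean geometry of a triangle *)

Section plane_geometry.
Context {R : realType}.
Implicit Types (x y p q r : R * R).

Definition det2 x y : R := x.1 * y.2 - x.2 * y.1.

Lemma dotDr g x y : dot g (x + y) = dot g x + dot g y.
Proof. by rewrite /dot /=; ring. Qed.

Lemma dotBr g x y : dot g (x - y) = dot g x - dot g y.
Proof. by rewrite /dot /=; ring. Qed.

Lemma dotZr g (a : R) x : dot g (a *: x) = a * dot g x.
Proof. by rewrite /dot /= /GRing.scale /=; ring. Qed.

Lemma dot_sum g (I : finType) (P : pred I) (w : I -> R) (F : I -> R * R) :
  dot g (\sum_(i | P i) w i *: F i) = \sum_(i | P i) w i * dot g (F i).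
Proof.
elim/big_rec2 : _ => [|i a b _ <-]; first by rewrite /dot /= !mulr0 addr0.
by rewrite dotDr dotZr.
Qed.

Lemma dotxx_ge0 x : 0 <= dot x x.
Proof. by rewrite addr_ge0 // -expr2 sqr_ge0. Qed.

Lemma enorm_ge0 x : 0 <= enorm x.
Proof. exact: sqrtr_ge0. Qed.

Lemma sqr_enorm x : enorm x ^+ 2 = dot x x.
Proof. by rewrite sqr_sqrtr // dotxx_ge0. Qed.

Lemma enorm_gt0 x : x != 0 -> 0 < enorm x.
Proof.
move=> x0; rewrite sqrtr_gt0 lt_neqAle dotxx_ge0 andbT eq_sym.
apply: contra x0; rewrite /dot -!expr2 paddr_eq0 ?sqr_ge0 // !sqrf_eq0.
by case/andP => /eqP a /eqP b; rewrite [x]surjective_pairing a b.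
Qed.

(** Serves twice: it yields Cauchy-Schwarz, and it turns [1 - cos ^ 2] into a squared determinant in
    the formula for the sine. *)
Lemma lagrange_identity x y :
  (enorm x * enorm y) ^+ 2 = dot x y ^+ 2 + det2 x y ^+ 2.
Proof. by rewrite exprMn !sqr_enorm /dot /det2; ring. Qed.

Lemma normr_dot_le x y : `|dot x y| <= enorm x * enorm y.
Proof.
rewrite -(@ler_pXn2r _ 2) ?nnegrE ?mulr_ge0 ?enorm_ge0 //.
by rewrite lagrange_identity real_normK ?num_real // lerDl sqr_ge0.
Qed.

Lemma det2_neq0 x y : det2 x y != 0 -> x != 0 /\ y != 0.
Proof.
move=> d; split; apply: contra d => /eqP ->; rewrite /det2 /=.
  by rewrite !mul0r subr0.
by rewrite !mulr0 subr0.
Qed.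

Lemma cos_angle_bounds p q r :
  -1 <= dot (q - p) (r - p) / (enorm (q - p) * enorm (r - p)) <= 1.
Proof.
rewrite -ler_norml normrM normfV.
have h := normr_dot_le (q - p) (r - p).
have := mulr_ge0 (enorm_ge0 (q - p)) (enorm_ge0 (r - p)).
(* If a side has length 0, the quotient is 0 because the inverse of 0 is 0. *)
rewrite le_eqVlt => /predU1P[<-|h0]; first by rewrite normr0 invr0 mulr0.
by rewrite (gtr0_norm h0) ler_pdivrMr // mul1r.
Qed.

Lemma cos_angle p q r : det2 (q - p) (r - p) != 0 ->
  enorm (q - p) * enorm (r - p) * cos (angle p q r) = dot (q - p) (r - p).
Proof.
move=> /det2_neq0[/enorm_gt0 h1 /enorm_gt0 h2]; rewrite acosK; last first.
  by rewrite in_itv /= cos_angle_bounds.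
by rewrite mulrC divfK // mulf_neq0 // gt_eqF.
Qed.

Lemma sin_angle p q r : det2 (q - p) (r - p) != 0 ->
  sin (angle p q r) =
    `|det2 (q - p) (r - p)| / (enorm (q - p) * enorm (r - p)).
Proof.
move=> /det2_neq0[/enorm_gt0 h1 /enorm_gt0 h2].
rewrite sin_acos ?cos_angle_bounds //.
set l := enorm (q - p) * enorm (r - p).
have l0 : 0 < l by rewrite mulr_gt0.
transitivity (Num.sqrt ((`|det2 (q - p) (r - p)| / l) ^+ 2)); last first.
  by rewrite sqrtr_sqr ger0_norm // divr_ge0 // ltW.
congr Num.sqrt; rewrite !expr_div_n real_normK ?num_real //.
have l20 : l ^+ 2 != 0 by rewrite expf_neq0 // gt_eqF.
apply: (mulIf l20); rewrite mulrBl mul1r !divfK //.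
by have := lagrange_identity (q - p) (r - p); rewrite -/l => ->;
  rewrite addrC addKr.
Qed.

Lemma enorm_distrC x y : enorm (x - y) = enorm (y - x).
Proof. rewrite /enorm; congr Num.sqrt; rewrite /dot /=; ring. Qed.

(** Both sines have the same determinant, twice the area, as numerator; only side lengths survive in
    the quotient. *)
Lemma law_of_sines p q r : det2 (q - p) (r - p) != 0 ->
  sin (angle p q r) / sin (angle q r p) = enorm (r - q) / enorm (p - r).
Proof.
move=> d.
have e : det2 (r - q) (p - q) = det2 (q - p) (r - p) by rewrite /det2 /=; ring.
have [/enorm_gt0 h1 /enorm_gt0 h2] := det2_neq0 _ _ d.
have := d; rewrite -e => /det2_neq0[/enorm_gt0 h3 /enorm_gt0 h4].
have d0 : 0 < `|det2 (q - p) (r - p)| by rewrite normr_gt0.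
rewrite sin_angle // sin_angle e // (enorm_distrC p q) (enorm_distrC p r).
by field; rewrite !gt_eqF.
Qed.

(** [h] has difference [- s] along the two edges at [p]: it is [s] times the
    gradient of the barycentric coordinate of [p]. *)
Lemma dot_grad_bary (s : R) g h p q r :
    dot h (q - p) = - s -> dot h (r - p) = - s ->
  det2 (q - p) (r - p) ^+ 2 * dot g h =
  - s * (dot g (q - p) * dot (p - r) (q - r)
         + dot g (r - p) * dot (r - q) (p - q)).
Proof.
move=> hq hr.
transitivity (dot g (q - p) * (dot h (q - p) * dot (r - p) (r - p)
   - dot h (r - p) * dot (q - p) (r - p)) +
   dot g (r - p) * (dot h (r - p) * dot (q - p) (q - p)
   - dot h (q - p) * dot (q - p) (r - p))).
  by rewrite /dot /det2 /=; ring.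
by rewrite hq hr /dot /=; ring.
Qed.

End plane_geometry.

(** * Sign of the flux difference on a single triangle *)

Section triangle.
Context {R : realType}.
Implicit Types (p q r g : R * R).

(** After multiplication by the squared determinant, [dot_grad_bary] expresses both inner products
    through edge differences and the cosines at [q] and [r]. The part in [gw - gu] is bounded below
    by [ka] and [c], the part in [kw - ku] is bounded above by [L0], [d] and [osc], and [small]
    makes the first win. *)
Lemma cotangent_gap (s t ka L0 c gam osc kw ku d : R) gu gw h p q r
    (D0 : det2 (q - p) (r - p) != 0) (ka_gt0 : 0 < ka) (L0_gt0 : 0 < L0)
    (gam_gt0 : 0 < gam) (gam_le1 : gam <= 1)
    (gam_qr : gam * enorm (p - r) <= enorm (p - q))
    (gam_rq : gam * enorm (p - q) <= enorm (p - r))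
    (cos_q : c <= cos (angle q r p)) (cos_r : c <= cos (angle r p q))
    (small : gam^-1 * (1 + gam^-1) * osc < 6 * ka * c / (7 * L0))
    (kw_gt : ka < kw) (k_lip : `|kw - ku| <= L0 * d)
    (s1 : `|s| = 1) (t1 : `|t| = 1)
    (hq : dot h (q - p) = - s) (hr : dot h (r - p) = - s)
    (osc_q : `|dot gu (q - p)| <= osc) (osc_r : `|dot gu (r - p)| <= osc)
    (sq : 0 < - (s * t) * dot (gw - gu) (q - p))
    (sr : 0 < - (s * t) * dot (gw - gu) (r - p))
    (d_le : d <= - (s * t) * dot (gw - gu) (q - p)
                 + - (s * t) * dot (gw - gu) (r - p)) :
  0 < t * (kw * dot gw h - ku * dot gu h).
Proof.
have D2 : 0 < det2 (q - p) (r - p) ^+ 2 by rewrite exprn_even_gt0.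
have := dot_grad_bary s (gw - gu) h p q r hq hr.
have := dot_grad_bary s gu h p q r hq hr.
have Dr : det2 (p - r) (q - r) != 0.
  suff -> : det2 (p - r) (q - r) = det2 (q - p) (r - p) by [].
  by rewrite /det2 /=; ring.
have Dq : det2 (r - q) (p - q) != 0.
  suff -> : det2 (r - q) (p - q) = det2 (q - p) (r - p) by [].
  by rewrite /det2 /=; ring.
have [/enorm_gt0 lq_gt0 /enorm_gt0] := det2_neq0 _ _ Dr.
rewrite enorm_distrC => lp_gt0.
have [_ /enorm_gt0 lr_gt0] := det2_neq0 _ _ Dq.
rewrite -(cos_angle _ _ _ Dr) -(cos_angle _ _ _ Dq) (enorm_distrC q r).
have {cos_q cos_r} := (cos_q, cos_r, cos_le1 (angle q r p), cos_le1 (angle r p q)).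
move: gam_qr gam_rq lp_gt0 lq_gt0 lr_gt0 sq sr d_le.
(* [lp], [lq], [lr] are the sides opposite to [p], [q], [r]; below, [al] and [be] are the positive
   differences along the edges from [p] to [q] and to [r]. *)
move: (enorm (r - q)) (enorm (p - r)) (enorm (p - q)) => lp lq lr.
move: (cos (angle q r p)) (cos (angle r p q)) => Cq Cr gam_qr gam_rq lp0 lq0 lr0.
set al := _ * dot _ (q - p); set be := _ * dot _ (r - p).
move=> al0 be0 d_le [[[cq cr] cq1] cr1] hu he.
have osc0 : 0 <= osc by apply: le_trans osc_q.
have gV : 1 <= gam^-1 by rewrite invf_ge1.
have gV0 : 0 < gam^-1 by rewrite invr_gt0.
(* A weaker form suffices: a factor [gam^-1], at least 1, and the factor 6/7 are given up. *)
have {}small : L0 * (osc * (1 + gam^-1)) < ka * c.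
  have a0 : 0 <= osc * (1 + gam^-1) by rewrite mulr_ge0 // addr_ge0 // ltW.
  have a1 : osc * (1 + gam^-1) <= gam^-1 * (1 + gam^-1) * osc.
    by rewrite -mulrA [X in _ <= _ * X]mulrC ler_peMl.
  move: small; rewrite ltr_pdivlMr ?mulr_gt0 // => small.
  have := ler_wpM2l (ltW L0_gt0) a1.
  have := mulr_ge0 (ltW L0_gt0) a0.
  move: small; move: (gam^-1 * _ * _) (osc * _) => X Y; lra.
(* The left side of [small] is nonnegative, so [ka * c] is positive. *)
have c0 : 0 < c.
  rewrite -(pmulr_rgt0 _ ka_gt0); apply: le_lt_trans small.
  by rewrite !mulr_ge0 ?addr_ge0 // ltW.
(* The ratio bound on the sides gives [lq + lr <= (1 + gam^-1) * lq], and symmetrically for [lr]. *)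
have lqS : L0 * osc * (lq + lr) < ka * c * lq.
  apply: le_lt_trans (_ : L0 * (osc * (1 + gam^-1)) * lq < _).
    have e : lr <= gam^-1 * lq by rewrite ler_pdivlMl.
    rewrite !mulrA -[X in _ <= X]mulrA ler_wpM2l ?mulr_ge0 ?(ltW L0_gt0)//.
    by rewrite mulrDl mul1r lerD2l.
  by rewrite ltr_pM2r.
have lrS : L0 * osc * (lq + lr) < ka * c * lr.
  apply: le_lt_trans (_ : L0 * (osc * (1 + gam^-1)) * lr < _).
    have e : lq <= gam^-1 * lr by rewrite ler_pdivlMl.
    rewrite !mulrA -[X in _ <= X]mulrA ler_wpM2l ?mulr_ge0 ?(ltW L0_gt0)//.
    by rewrite mulrDl mul1r addrC lerD2l.
  by rewrite ltr_pM2r.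
have key : L0 * (al + be) * osc * (lp * (lq + lr)) <
    ka * (lp * c * (al * lq + be * lr)).
  have := ltr_pM2l al0 (L0 * osc * (lq + lr)) (ka * c * lq); rewrite lqS => h1.
  have := ltr_pM2l be0 (L0 * osc * (lq + lr)) (ka * c * lr); rewrite lrS => h2.
  rewrite (_ : _ * (lp * _) = lp * (al * (L0 * osc * (lq + lr)) +
    be * (L0 * osc * (lq + lr)))); last by ring.
  rewrite (_ : _ * (lp * _ * _) = lp * (al * (ka * c * lq) +
    be * (ka * c * lr))); last by ring.
  by rewrite ltr_pM2l // ltrD.
rewrite -(pmulr_rgt0 _ D2).
set Ck := lq * lp * Cr in hu he; set Cj := lp * lr * Cq in hu he.
have Ck_ge : lp * c * lq <= Ck.
  by rewrite /Ck (mulrC lq) -!mulrA ler_pM2l // mulrC ler_pM2l.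
have Cj_ge : lp * c * lr <= Cj.
  by rewrite /Cj -!mulrA ler_pM2l // mulrC ler_pM2l.
have Ck_le : Ck <= lp * lq.
  by rewrite /Ck (mulrC lq) ger_pMr // mulr_gt0.
have Cj_le : Cj <= lp * lr by rewrite /Cj ger_pMr // mulr_gt0.
have Ck0 : 0 <= Ck by apply: le_trans Ck_ge; rewrite !mulr_ge0 // ltW.
have Cj0 : 0 <= Cj by apply: le_trans Cj_ge; rewrite !mulr_ge0 // ltW.
set D := det2 _ _ in D2 hu he *; clearbody Ck Cj D.
(* The splitting is [kw gw - ku gu = kw (gw - gu) + (kw - ku) gu]. *)
have -> : D ^+ 2 * (t * (kw * dot gw h - ku * dot gu h)) =
    kw * (al * Ck + be * Cj) + t * (kw - ku) * (D ^+ 2 * dot gu h).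
  have e : dot gw h = dot (gw - gu) h + dot gu h by rewrite /dot /=; ring.
  transitivity (kw * (t * (D ^+ 2 * dot (gw - gu) h)) +
      t * (kw - ku) * (D ^+ 2 * dot gu h)); first by rewrite e; ring.
  by congr (_ + _); rewrite he /al /be; ring.
have bu : `|t * (kw - ku) * (D ^+ 2 * dot gu h)| <=
    L0 * (al + be) * osc * (lp * (lq + lr)).
  rewrite hu !normrM t1 mul1r normrN s1 mul1r -[X in _ <= X]mulrA.
  apply: ler_pM => //; first by apply: le_trans k_lip _; rewrite ler_wpM2l // ltW.
  apply: le_trans (ler_normD _ _) _.
  rewrite !normrM (ger0_norm Ck0) (ger0_norm Cj0).
  by rewrite mulrDr mulrDr lerD // ler_pM.
clearbody al be.
have be1 : ka * (lp * c * (al * lq + be * lr)) <= kw * (al * Ck + be * Cj).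
  apply: ler_pM => //; [exact: ltW| |exact: ltW|].
    by rewrite ltW // mulr_gt0 ?addr_gt0 ?mulr_gt0.
  rewrite mulrDr !mulrA [_ * al]mulrC [_ * be]mulrC -!mulrA.
  by rewrite lerD // ler_pM2l // !mulrA.
move: bu; rewrite ler_norml => /andP[bu _]; lra.
Qed.

(** Addition in ['I_3] is modulo 3, so [i], [i + 1], [i + 2] list the vertices cyclically from any
    start. *)
Lemma ord3P (i : 'I_3) :
  [/\ i + 1 + 1 = i + 2, i + 1 + 2 = i, i + 2 + 1 = i & i + 2 + 2 = i + 1].
Proof. by split; case: i => -[|[|[|//]]] ? /=; apply/val_inj. Qed.

Lemma ord3_cover (i j : 'I_3) : [\/ j = i, j = i + 1 | j = i + 2].
Proof.
case: i j => -[|[|[|//]]] ? [[|[|[|//]]] ?] /=;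
  by [apply: Or31; apply/val_inj|apply: Or32; apply/val_inj
     |apply: Or33; apply/val_inj].
Qed.

Lemma gammaT_le (a : 'I_3 -> R * R) i j :
  gammaT a <= sin (interior_angle a i) / sin (interior_angle a j).
Proof.
by apply: le_trans (bigmin_le_cond _ _ _) _ => //; exact: bigmin_le_cond.
Qed.

Lemma gammaT_le1 (a : 'I_3 -> R * R) : gammaT a <= 1.
Proof. exact: bigmin_le_id. Qed.

Lemma cT_le (a : 'I_3 -> R * R) i : cT a <= cos (interior_angle a i).
Proof. exact: bigmin_le_cond. Qed.

Lemma oscT_ge (a : 'I_3 -> R * R) u i j : `|u (a i) - u (a j)| <= oscT a u.
Proof. by apply: le_trans (le_bigmax _ _ i); exact: (le_bigmax _ _ j). Qed.

(** Pigeonhole: two of three bits agree, and the remaining index is the [k] sought. *)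
Lemma bool_odd_one_out (b : 'I_3 -> bool) (i j : 'I_3) : b i != b j ->
  exists k, b (k + 1) = ~~ b k /\ b (k + 2) = ~~ b k.
Proof.
have [-> | -> | ->] := ord3_cover i j; first by rewrite eqxx.
- have [e1 e2 e3 e4] := ord3P i; case Ei : (b i); case Ej : (b (i + 1)) => // _;
    case Ek : (b (i + 2)).
  + by exists (i + 1); rewrite e1 e2 Ei Ej Ek.
  + by exists i; rewrite Ei Ej Ek.
  + by exists i; rewrite Ei Ej Ek.
  + by exists (i + 1); rewrite e1 e2 Ei Ej Ek.
- have [e1 e2 e3 e4] := ord3P i; case Ei : (b i); case Ej : (b (i + 2)) => // _;
    case Ek : (b (i + 1)).
  + by exists (i + 2); rewrite e3 e4 Ei Ej Ek.
  + by exists i; rewrite Ei Ej Ek.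
  + by exists i; rewrite Ei Ej Ek.
  + by exists (i + 2); rewrite e3 e4 Ei Ej Ek.
Qed.

(** On a triangle where the nodal sign of [t * (w - u)] changes, a vertex [i]
    has the opposite sign of the other two, so both differences
    [t * (w - u) (a i) - t * (w - u) (a j)] have the same strict sign, and
    together they dominate [w - u] on the triangle. *)
Lemma mixed_cell_gap (a : 'I_3 -> R * R) (ka L0 t kw ku d : R)
    (u w v : R * R -> R) (cu cw cv : R) gu gw h i j
    (nondeg : forall i, det2 (a (i + 1) - a i) (a (i + 2) - a i) != 0)
    (ka_gt0 : 0 < ka) (L0_gt0 : 0 < L0)
    (small : (gammaT a)^-1 * (1 + (gammaT a)^-1) * oscT a u
       < 6 * ka * cT a / (7 * L0))
    (kw_gt : ka < kw) (k_lip : `|kw - ku| <= L0 * d)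
    (t1 : `|t| = 1)
    (ua : forall k, u (a k) = cu + dot gu (a k))
    (wa : forall k, w (a k) = cw + dot gw (a k))
    (va : forall k, v (a k) = cv + dot h (a k))
    (vE : forall k, v (a k) = (0 < t * (w (a k) - u (a k)))%R%:R)
    (mixed : v (a i) != v (a j))
    (d_le : forall m, (forall k, `|w (a k) - u (a k)| <= m) -> d <= m) :
  0 < t * (kw * dot gw h - ku * dot gu h).
Proof.
set E := fun k => t * (w (a k) - u (a k)).
have EE k : `|w (a k) - u (a k)| = `|E k| by rewrite normrM t1 mul1r.
have [i0 [b1 b2]] : exists k, (0 < E (k + 1)) = ~~ (0 < E k) /\
    (0 < E (k + 2)) = ~~ (0 < E k).
  apply: (bool_odd_one_out (fun k => 0 < E k) i j).
  by apply: contra mixed; rewrite !vE => /eqP ->.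
have [e1 e2 e3 e4] := ord3P i0.
(* [s] is 1 if [E i0] is positive and -1 otherwise; it is also the drop of [v] from [a i0] to either
   other vertex. *)
set s : R := (-1) ^+ (~~ (0 < E i0)).
have s1 : `|s| = 1 by rewrite normr_sign.
have gamr k l : 0 < sin (interior_angle a k) / sin (interior_angle a l).
  have sn m : 0 < sin (interior_angle a m).
    have [/enorm_gt0 h1 /enorm_gt0 h2] := det2_neq0 _ _ (nondeg m).
    by rewrite sin_angle // divr_gt0 ?mulr_gt0 // normr_gt0.
  by rewrite divr_gt0.
have gam0 : 0 < gammaT a.
  by apply/bigmin_gtP; split => // k _; apply/bigmin_gtP; split.
have angE k : interior_angle a (k + 1) = angle (a (k + 1)) (a (k + 2)) (a k).
  by have [f1 f2 _ _] := ord3P k; rewrite /interior_angle f1 f2.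
have angE2 k : interior_angle a (k + 2) = angle (a (k + 2)) (a k) (a (k + 1)).
  by have [_ _ f1 f2] := ord3P k; rewrite /interior_angle f1 f2.
have n1 := nondeg (i0 + 1); rewrite e1 e2 in n1.
have [/enorm_gt0 lqr /enorm_gt0 lqp] := det2_neq0 _ _ n1.
have n2 := nondeg (i0 + 2); rewrite e3 e4 in n2.
have [/enorm_gt0 lrp _] := det2_neq0 _ _ n2.
have sinE : sin (interior_angle a (i0 + 1)) / sin (interior_angle a (i0 + 2)) =
    enorm (a i0 - a (i0 + 2)) / enorm (a i0 - a (i0 + 1)).
  by rewrite angE angE2 law_of_sines // (enorm_distrC (a (i0 + 1))).
have cos1 := cT_le a (i0 + 1); rewrite angE in cos1.
have cos2 := cT_le a (i0 + 2); rewrite angE2 in cos2.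
have hB k l : dot h (a k - a l) = v (a k) - v (a l).
  by rewrite !va dotBr; ring.
have eB k l : t * dot (gw - gu) (a k - a l) = E k - E l.
  by rewrite /E !ua !wa /dot /=; ring.
(* One of the two values is positive and the other is at most 0, so their distance is the sum of
   their absolute values and is positive. *)
have sB k : (0 < E k) = ~~ (0 < E i0) -> 0 < s * (E i0 - E k) /\
    `|E k| <= s * (E i0 - E k) /\ `|E i0| <= s * (E i0 - E k).
  rewrite /s; case: (ltP 0 (E i0)) => Ei; case: (ltP 0 (E k)) => //= Ek _.
    by rewrite expr0 mul1r (ler0_norm Ek) (gtr0_norm Ei); split; [|split]; lra.
  by rewrite expr1 mulN1r (ler0_norm Ei) (gtr0_norm Ek); split; [|split]; lra.
have vB k : (0 < E k) = ~~ (0 < E i0) -> v (a k) - v (a i0) = - s.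
  rewrite !vE -/(E k) -/(E i0) /s => ->.
  by case: (0 < E i0); rewrite /= ?expr0 ?expr1; ring.
have stE k : - (s * t) * dot (gw - gu) (a k - a i0) = s * (E i0 - E k).
  by rewrite -[E i0 - E k]opprB -eB; ring.
have [s11 [s12 s13]] := sB _ b1; have [s21 [s22 s23]] := sB _ b2.
apply: (@cotangent_gap s t ka L0 (cT a) (gammaT a) (oscT a u) kw ku d gu gw h
  (a i0) (a (i0 + 1)) (a (i0 + 2))) => //.
- exact: gammaT_le1.
- by rewrite -ler_pdivlMr // -invf_div -sinE invf_div; exact: gammaT_le.
- by rewrite -ler_pdivlMr // -sinE; exact: gammaT_le.
- by rewrite hB vB.
- by rewrite hB vB.
- rewrite (_ : dot gu _ = u (a (i0 + 1)) - u (a i0)) ?oscT_ge // !ua dotBr; ring.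
- rewrite (_ : dot gu _ = u (a (i0 + 2)) - u (a i0)) ?oscT_ge // !ua dotBr; ring.
- by rewrite stE.
- by rewrite stE.
- rewrite !stE; apply: d_le => k; rewrite EE.
  have [-> | -> | ->] := ord3_cover i0 k; lra.
Qed.

End triangle.

(** * Barycentric coordinates *)

Section barycentric.
Context {R : realType} (a : 'I_3 -> R * R).
Hypothesis nondeg : forall i, det2 (a (i + 1) - a i) (a (i + 2) - a i) != 0.

(** Ratio of signed areas: the triangle with vertex [i] moved to [x], over the whole triangle. *)
Definition bary (i : 'I_3) (x : R * R) : R :=
  det2 (a (i + 1) - x) (a (i + 2) - x) / det2 (a (i + 1) - a i) (a (i + 2) - a i).

Lemma sum_ord3 (V : zmodType) (F : 'I_3 -> V) (i : 'I_3) :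
  \sum_j F j = F i + F (i + 1) + F (i + 2).
Proof.
rewrite !big_ord_recl big_ord0 addr0.
case: i => -[|[|[|//]]] p; rewrite /=.
- by rewrite addrA; congr (_ + _ + _); congr F; apply/val_inj.
- rewrite [RHS]addrC; congr (_ + _); [|congr (_ + _)]; congr F; exact/val_inj.
- rewrite -[RHS]addrA [RHS]addrC -addrA; congr (_ + _); [|congr (_ + _)];
    congr F; exact/val_inj.
Qed.

Lemma ord3_neq (i : 'I_3) : (i == i + 1) = false /\ (i == i + 2) = false.
Proof. by split; apply/negbTE; case: i => -[|[|[|//]]] ?. Qed.

Lemma bary_vertex i j : bary i (a j) = (i == j)%:R.
Proof.
have [n1 n2] := ord3_neq i; have [-> | -> | ->] := ord3_cover i j.
- by rewrite /bary eqxx divff.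
- by rewrite n1 /bary /det2 /=; ring.
- by rewrite n2 /bary /det2 /=; ring.
Qed.

(** The gradient is nonzero because the values 1 and 0 occur at two vertices; hence the zero set of
    a coordinate is a line, which will be a null set. *)
Lemma bary_affine i : exists (c : R) (g : R * R),
  g != 0 /\ forall x, bary i x = c + dot g x.
Proof.
set D := det2 (a (i + 1) - a i) (a (i + 2) - a i).
pose g : R * R := (((a (i + 1)).2 - (a (i + 2)).2) / D,
   ((a (i + 2)).1 - (a (i + 1)).1) / D).
have gE x : bary i x = det2 (a (i + 1)) (a (i + 2)) / D + dot g x.
  by rewrite /bary -/D /dot /det2 /=; ring.
exists (det2 (a (i + 1)) (a (i + 2)) / D), g; split => //.
apply: contraNneq (oner_neq0 R) => g0.
have := gE (a (i + 1)); have := gE (a i).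
rewrite !bary_vertex eqxx (ord3_neq i).1 g0 /dot /= !mul0r => <- /eqP.
by rewrite eq_sym.
Qed.

Let det_rot i : det2 (a (i + 1 + 1) - a (i + 1)) (a (i + 1 + 2) - a (i + 1)) =
  det2 (a (i + 1) - a i) (a (i + 2) - a i).
Proof. by have [-> -> _ _] := ord3P i; rewrite /det2 /=; ring. Qed.

(** The three denominators agree by cyclic invariance of the determinant; clearing them leaves a
    polynomial identity. *)
Lemma affine_bary (c : R) (g : R * R) x :
  c + dot g x = \sum_i bary i x * (c + dot g (a i)).
Proof.
have D0 := nondeg 0; rewrite (sum_ord3 _ _ 0) /bary.
have := det_rot 0; have := det_rot (0 + 1); have [-> -> -> ->] := ord3P 0 => -> ->.
rewrite !(mulrAC _ _^-1) -!mulrDl.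
apply: (mulIf D0); rewrite divfK //.
by rewrite /det2 /dot /=; ring.
Qed.

Lemma sum_bary x : \sum_i bary i x = 1.
Proof.
have := affine_bary 1 0 x; rewrite {1}/dot /= !mul0r !addr0 => {1}->.
by apply: eq_bigr => i _; rewrite /dot /= !mul0r !addr0 mulr1.
Qed.

Lemma bary_comb x : \sum_i bary i x *: a i = x.
Proof.
rewrite [RHS]surjective_pairing (sum_ord3 _ _ 0) /=.
have := affine_bary 0 (1, 0) x.
rewrite (sum_ord3 _ _ 0) /dot /= !(mul0r, mul1r, addr0, add0r) => {1}->.
by have := affine_bary 0 (0, 1) x;
  rewrite (sum_ord3 _ _ 0) /dot /= !(mul0r, mul1r, addr0, add0r) => {1}->.
Qed.

Lemma bary_interp_affine (z : 'I_3 -> R) :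
  exists (c : R) (g : R * R), forall x, \sum_i bary i x * z i = c + dot g x.
Proof.
have [c0 [g0 [_ E0]]] := bary_affine 0.
have [c1 [g1 [_ E1]]] := bary_affine (0 + 1).
have [c2 [g2 [_ E2]]] := bary_affine (0 + 2).
exists (c0 * z 0 + c1 * z (0 + 1) + c2 * z (0 + 2)).
exists (z 0 *: g0 + z (0 + 1) *: g1 + z (0 + 2) *: g2) => x.
by rewrite (sum_ord3 _ _ 0) E0 E1 E2 /dot /= /GRing.scale /=; ring.
Qed.

(** Equal vertex values make the barycentric expansion constant; evaluation at the two unit vectors
    then reads off [g]. *)
Lemma grad_eq0 (c : R) (g : R * R) :
  (forall i j, c + dot g (a i) = c + dot g (a j)) -> g = 0.
Proof.
move=> h; have E x : dot g x = dot g 0.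
  apply: (addrI c); rewrite affine_bary [RHS]affine_bary.
  under eq_bigr do rewrite (h _ 0).
  under [RHS]eq_bigr do rewrite (h _ 0).
  by rewrite -!mulr_suml !sum_bary.
have := E (1, 0); have := E (0, 1); rewrite /dot /= !(mulr0, mulr1, addr0, add0r).
by case: g {h E} => g1 g2 /= -> ->.
Qed.

End barycentric.

(** * The piecewise affine interpolant *)

Section mesh_geometry.
Context {R : realType} (M : mesh R).
Implicit Types (T : {ffun 'I_3 -> 'I_(nnodes M)}) (g x p q : R * R).

Lemma nondegenerate_det2 T : Defs.nondegenerate T -> forall i : 'I_3,
  det2 (vertices T (i + 1) - vertices T i)
       (vertices T (i + 2) - vertices T i) != 0.
Proof.
rewrite /Defs.nondegenerate; set a := vertices T => h.
have h0 : det2 (a (0 + 1) - a 0) (a (0 + 2) - a 0) != 0.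
  by rewrite !add0r /det2 /= subr_eq0.
have rot k : det2 (a (k + 1 + 1) - a (k + 1)) (a (k + 1 + 2) - a (k + 1)) =
    det2 (a (k + 1) - a k) (a (k + 2) - a k).
  by have [-> -> _ _] := ord3P k; rewrite /det2 /=; ring.
move=> i; have [->|->|->] := ord3_cover 0 i => //; first by rewrite rot.
by have [<- _ _ _] := ord3P 0; rewrite !rot.
Qed.

Lemma affine_hull (s : {set 'I_(nnodes M)}) (w : 'I_(nnodes M) -> R) (c : R) g :
  \sum_(i in s) w i = 1 ->
  c + dot g (\sum_(i in s) w i *: node M i) =
  \sum_(i in s) w i * (c + dot g (node M i)).
Proof.
move=> w1; under [RHS]eq_bigr do rewrite mulrDr.
by rewrite big_split /= -mulr_suml w1 mul1r dot_sum.
Qed.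

Lemma node_hull (s : {set 'I_(nnodes M)}) n : n \in s -> hull s (node M n).
Proof.
move=> ns; exists (fun m => (m == n)%:R); split => //.
- by rewrite (bigD1 n) //= eqxx big1 ?addr0 // => i /andP[_ /negbTE ->].
- rewrite (bigD1 n) //= eqxx scale1r big1 ?addr0 // => i /andP[_ /negbTE ->].
  by rewrite scale0r.
Qed.

Lemma segment_hull (s : {set 'I_(nnodes M)}) p q :
  hull s p -> hull s q -> segment p q `<=` hull s.
Proof.
move=> [w1 [w10 w11 ->]] [w2 [w20 w21 ->]] _ [t /= + <-].
rewrite in_itv /= => /andP[t0 t1].
exists (fun i => (1 - t) * w1 i + t * w2 i); split.
- by move=> i; rewrite addr_ge0 // mulr_ge0 // subr_ge0.
- by rewrite big_split /= -!mulr_sumr w11 w21 !mulr1 subrK.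
- rewrite /seg_path -sumrB scaler_sumr -big_split /=; apply: eq_bigr => i _.
  by rewrite -scalerBl scalerA -scalerDl; congr (_ *: _); ring.
Qed.

Lemma triangleP T x : Defs.nondegenerate T ->
  triangle T x <-> forall i, 0 <= bary (vertices T) i x.
Proof.
move=> /nondegenerate_det2 nd; split.
  move=> [w [w0 w1 ->]] i; have [c [g [_ E]]] := bary_affine _ nd i.
  rewrite E affine_hull // sumr_ge0 // => _ /imsetP[j _ ->].
  by rewrite -E bary_vertex // mulr_ge0.
(* Hulls carry weights on nodes and coordinates carry them on local indices, so the coordinates are
   regrouped by node. *)
move=> h; pose w n := \sum_(i | T i == n) bary (vertices T) i x.
have part (V : zmodType) (F : 'I_3 -> V) :
    \sum_i F i = \sum_(n in vertex_set T) \sum_(i | T i == n) F i.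
  by apply: partition_big => i _; exact: imset_f.
exists w; split.
- by move=> n; exact: sumr_ge0.
- by rewrite -part sum_bary.
- rewrite -[LHS](bary_comb _ nd) part; apply: eq_bigr => n _.
  by rewrite /w scaler_suml; apply: eq_bigr => i /eqP <-.
Qed.

(** The choice of a cell containing [x] is immaterial on a conforming mesh, by [interpE]; off the
    mesh the value is 0. *)
Definition interp (z : 'I_(nnodes M) -> R) x : R :=
  if [pick T in cells M | `[< triangle T x >]] is Some T
  then \sum_i bary (vertices T) i x * z (T i) else 0.

(** * Interpolation on a conforming mesh and gradients inside cells *)

Section conforming.
Context (Omega GammaD : set (R * R)).
Hypothesis conf : conforming_triangulation M Omega GammaD.

Let nondeg T : T \in cells M -> Defs.nondegenerate T.
Proof. by case: conf => -[_ h] _ _ _ _; exact: h. Qed.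

(** The right side does not mention [T]: on the hull of some of its vertices the local interpolant
    is determined by the values at those vertices alone. *)
Lemma interp_hull z (s : {set 'I_(nnodes M)}) T x :
  T \in cells M -> s \subset vertex_set T ->
  forall w, \sum_(n in s) w n = 1 -> x = \sum_(n in s) w n *: node M n ->
  \sum_i bary (vertices T) i x * z (T i) = \sum_(n in s) w n * z n.
Proof.
move=> TM sT w w1 ->; have nd := nondegenerate_det2 _ (nondeg _ TM).
have [c [g E]] := bary_interp_affine _ nd (fun i => z (T i)).
rewrite E affine_hull //; apply: eq_bigr => n ns; congr (_ * _).
have /imsetP[i _ ->] := fintype.subsetP sT _ ns.
rewrite -E (bigD1 i) //= bary_vertex // eqxx mul1r big1 ?addr0 // => j /negbTE ji.
by rewrite bary_vertex // ji mul0r.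
Qed.

(** If another cell is picked, conformity puts [x] in the hull of the common vertices, where both
    local formulas agree. *)
Lemma interpE z T x : T \in cells M -> triangle T x ->
  interp z x = \sum_i bary (vertices T) i x * z (T i).
Proof.
move=> TM Tx; rewrite /interp; case: pickP => [T' /andP[T'M /asboolP T'x]|];
  last first.
  by move=> /(_ T)/negbT/negP[]; apply/andP; split => //; exact/asboolP.
have [->//|/eqP T'T] := eqVneq T' T.
have [_ h _ _ _] := conf; have [_ TT] := h _ _ T'M TM T'T.
have [w [_ w1 xE]] : hull (vertex_set T' :&: vertex_set T) x by rewrite -TT.
by rewrite !(interp_hull _ _ _ _ _ _ _ w1 xE) // ?subsetIl ?subsetIr.
Qed.

Definition cell_interior T : set (R * R) :=
  [set x | forall i, 0 < bary (vertices T) i x].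

Lemma affine_continuous (c : R) g : continuous (fun x => c + dot g x).
Proof.
move=> x; apply: cvgD; first exact: cvg_cst.
apply: cvgD; apply: cvgM; try exact: cvg_cst.
  exact: cvg_fst.
exact: cvg_snd.
Qed.

Lemma bary_continuous T i : T \in cells M -> continuous (bary (vertices T) i).
Proof.
move=> /nondeg/nondegenerate_det2 nd; have [c [g [_ E]]] := bary_affine _ nd i.
by rewrite (funext E); exact: affine_continuous.
Qed.

Lemma closed_triangle T : T \in cells M -> closed (triangle T).
Proof.
move=> TM; rewrite (_ : triangle T =
    \bigcap_(i in [set: 'I_3]) [set x | 0 <= bary (vertices T) i x]).
  apply: closed_bigI => i _; apply: (@closed_comp _ _ _ [set y : R | 0 <= y]);
    last exact: closed_ge.
  by move=> x _; exact: bary_continuous.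
apply/seteqP; split => x /=; rewrite (triangleP _ _ (nondeg _ TM)).
  by move=> h i _; exact: h.
by move=> h i; exact: h.
Qed.

Lemma open_cell_interior T : T \in cells M -> open (cell_interior T).
Proof.
move=> TM; have oi i : open [set x | 0 < bary (vertices T) i x].
  apply: (@open_comp _ _ _ [set y : R | 0 < y]); last exact: open_gt.
  by move=> x _; exact: bary_continuous.
rewrite (_ : cell_interior T = [set x | 0 < bary (vertices T) 0 x] `&`
  [set x | 0 < bary (vertices T) (0 + 1) x] `&`
  [set x | 0 < bary (vertices T) (0 + 2) x]); first by do 2! apply: openI => //.
apply/seteqP; split => x /=; first by move=> h; split => //; split.
by case=> -[h0 h1 h2] i; have [->|->|->] := ord3_cover 0 i.
Qed.

Lemma cell_interior_sub T : T \in cells M -> cell_interior T `<=` triangle T.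
Proof.
by move=> TM x h; apply/(triangleP _ _ (nondeg _ TM)) => i; exact/ltW/h.
Qed.

Lemma cell_interior_neq0 T : T \in cells M -> cell_interior T !=set0.
Proof.
move=> TM; have nd := nondegenerate_det2 _ (nondeg _ TM).
pose a := vertices T.
(* The centroid has all coordinates equal to 1/3. *)
exists (3^-1 *: a 0 + 3^-1 *: a (0 + 1) + 3^-1 *: a (0 + 2)) => i.
have [c [g [_ E]]] := bary_affine _ nd i.
have -> : bary a i (3^-1 *: a 0 + 3^-1 *: a (0 + 1) + 3^-1 *: a (0 + 2)) =
    3^-1 * \sum_j bary a i (a j).
  by rewrite (sum_ord3 _ _ 0) !E !dotDr !dotZr; field.
have -> : \sum_j bary a i (a j) = 1; last by rewrite mulr1 invr_gt0.
rewrite (sum_ord3 _ _ i) !bary_vertex // eqxx.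
by have [-> ->] := ord3_neq i; rewrite !addr0.
Qed.

Lemma derive_affine (c : R) g e x : 'D_e (fun y => c + dot g y) x = dot g e.
Proof.
rewrite /derive; apply: cvg_lim => //; apply: cvg_near_cst.
near=> h; rewrite /= dotDr dotZr /GRing.scale /=.
have h0 : h != 0 by near: h; exact: nbhs_dnbhs_neq.
by rewrite addrCA addrK mulKf.
Unshelve. all: by end_near. Qed.

(** The cell interior is open, so [v] equals the affine function in a neighbourhood of [x] and has
    its derivatives there. *)
Lemma grad_cell T v (c : R) g x : T \in cells M ->
  (forall y, triangle T y -> v y = c + dot g y) ->
  cell_interior T x -> grad v x = g.
Proof.
move=> TM vE xT.
have nv : \forall y \near x, v y = c + dot g y.
  apply: filterS (open_nbhs_nbhs (conj (open_cell_interior _ TM) xT)) => y yT.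
  exact/vE/cell_interior_sub.
rewrite /grad !(near_eq_derive _ nv) !derive_affine [RHS]surjective_pairing.
by rewrite /dot /= !(mulr0, mulr1, addr0, add0r).
Qed.

End conforming.
End mesh_geometry.

(** Pasting lemma for finitely many closed sets, applied later to the triangles of the mesh. *)
Lemma within_bigsetU_continuous {T U : topologicalType} (I : eqType) (s : seq I)
    (F : I -> set T) (f : T -> U) :
  (forall i, i \in s -> closed (F i)) ->
  (forall i, i \in s -> {within F i, continuous f}) ->
  {within \big[setU/set0]_(i <- s) F i, continuous f}.
Proof.
elim: s => [|i s IHs] cF fF; first by rewrite big_nil; exact: continuous_subspace0.
rewrite big_cons; apply: withinU_continuous.
- by apply: cF; rewrite mem_head.
- by apply: closed_bigsetU => j js; apply: cF; rewrite in_cons js orbT.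
- by apply: fF; rewrite mem_head.
- by apply: IHs => j js; [apply: cF|apply: fF]; rewrite in_cons js orbT.
Qed.

(** * Membership of the interpolant in the discrete space *)

Section interpolant.
Context {R : realType} (M : mesh R) (Omega GammaD : set (R * R)).
Hypothesis conf : conforming_triangulation M Omega GammaD.
Implicit Types (T : {ffun 'I_3 -> 'I_(nnodes M)}) (g x p q : R * R).

Lemma cell_nondegenerate T : T \in cells M -> Defs.nondegenerate T.
Proof. by case: conf => -[_ h] _ _ _ _; exact: h. Qed.

Lemma cell_nondeg T : T \in cells M -> forall i : 'I_3,
  det2 (vertices T (i + 1) - vertices T i)
       (vertices T (i + 2) - vertices T i) != 0.
Proof. by move=> TM; apply: nondegenerate_det2; exact: cell_nondegenerate. Qed.

Lemma closure_cells x : closure Omega x ->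
  exists2 T, T \in cells M & triangle T x.
Proof. by case: conf => _ _ -> _ _ [T /= TM Tx]; exists T. Qed.

Lemma triangle_closure T : T \in cells M -> triangle T `<=` closure Omega.
Proof. by move=> TM x Tx; case: conf => _ _ -> _ _; exists T. Qed.

Lemma triangle_vertex T i : triangle T (vertices T i).
Proof. by apply: node_hull; exact: imset_f. Qed.

Lemma interp_affine (z : 'I_(nnodes M) -> R) T : T \in cells M ->
  exists c g, forall x, triangle T x -> interp M z x = c + dot g x.
Proof.
move=> TM.
have [c [g E]] := bary_interp_affine _ (cell_nondeg _ TM) (fun i => z (T i)).
by exists c, g => x Tx; rewrite (interpE _ _ _ conf _ _ _ TM Tx) E.
Qed.

Lemma interp_node (z : 'I_(nnodes M) -> R) T i : T \in cells M ->
  interp M z (vertices T i) = z (T i).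
Proof.
move=> TM; rewrite (interpE _ _ _ conf _ _ _ TM (triangle_vertex T i)).
have nd := cell_nondeg _ TM.
rewrite (sum_ord3 _ _ i) !bary_vertex // eqxx.
have -> : (i + 1 == i) = false by rewrite eq_sym (ord3_neq i).1.
have -> : (i + 2 == i) = false by rewrite eq_sym (ord3_neq i).2.
by rewrite mul1r !mul0r !addr0.
Qed.

Lemma interp_continuous (z : 'I_(nnodes M) -> R) :
  {within closure Omega, continuous (interp M z)}.
Proof.
have -> : closure Omega = \big[setU/set0]_(T <- enum (cells M)) triangle T.
  rewrite -bigcup_seq; case: conf => _ _ -> _ _.
  by apply: eq_bigcupl; split => T /=; rewrite mem_enum.
apply: within_bigsetU_continuous => T; rewrite mem_enum => TM.
  exact: closed_triangle conf _ TM.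
have [c [g E]] := interp_affine z _ TM.
apply: (@subspace_eq_continuous _ _ _ (fun x => c + dot g x)).
  by move=> x /set_mem Tx; apply: esym; exact: E.
by apply: continuous_subspaceT; exact: affine_continuous.
Qed.

Lemma edge_cell (e : 'I_(nnodes M) * 'I_(nnodes M)) :
  e \in boundary_edges M Omega -> exists T, [/\ T \in cells M,
    e.1 \in vertex_set T, e.2 \in vertex_set T &
    segment (node M e.1) (node M e.2) `<=` triangle T].
Proof.
rewrite inE => /andP[+ _]; rewrite inE.
move=> /andP[_ /existsP[T /andP[TM /andP[e1 e2]]]].
exists T; split => //; apply: segment_hull; exact: node_hull.
Qed.

(** The points at one third and two thirds already determine an affine function on the line. This
    carries the Dirichlet condition to end points of edges, which may lie outside [GammaD]. *)
Lemma affine_segment_eq0 (c : R) g p q :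
  (forall x, open_segment p q x -> c + dot g x = 0) ->
  c + dot g p = 0 /\ c + dot g q = 0.
Proof.
move=> h.
have h1 : c + dot g (seg_path p q 3^-1) = 0.
  by apply: h; exists 3^-1 => //=; rewrite in_itv /=; apply/andP; split; lra.
have h2 : c + dot g (seg_path p q (2 / 3)) = 0.
  by apply: h; exists (2 / 3) => //=; rewrite in_itv /=; apply/andP; split; lra.
move: h1 h2; rewrite /seg_path !dotDr !dotZr dotBr; split; lra.
Qed.

Lemma V0D_boundary_node u (e : 'I_(nnodes M) * 'I_(nnodes M)) :
  V0D M Omega GammaD u -> e \in boundary_edges M Omega ->
  open_segment (node M e.1) (node M e.2) `<=` GammaD ->
  u (node M e.1) = 0 /\ u (node M e.2) = 0.
Proof.
move=> [_ uaff uD] eb oD; have [T [TM e1 e2 eT]] := edge_cell _ eb.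
have [c [g E]] := uaff _ TM.
rewrite !E; try exact: node_hull.
apply: affine_segment_eq0 => x ex; rewrite -E; first exact/uD/oD.
apply: eT; case: ex => t /= + <-; rewrite in_itv /= => /andP[t0 t1].
by exists t => //=; rewrite in_itv /= !ltW.
Qed.

(** A point of [GammaD] lies on a boundary edge. If it is an end point, it is a node in [GammaD];
    otherwise the open edge meets [GammaD] and is therefore contained in it, so both end values
    vanish. *)
Lemma interp_V0D (z : 'I_(nnodes M) -> R) :
  GammaD `<=` frontier Omega ->
  (forall n, GammaD (node M n) -> z n = 0) ->
  (forall e, e \in boundary_edges M Omega ->
     open_segment (node M e.1) (node M e.2) `<=` GammaD ->
     z e.1 = 0 /\ z e.2 = 0) ->
  V0D M Omega GammaD (interp M z).
Proof.
move=> Dsub zn ze; split; first exact: interp_continuous.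
  by move=> T TM; have [c [g E]] := interp_affine z _ TM; exists c, g.
move=> x Dx; case: (conf) => _ _ _ fr bd.
move: (Dsub _ Dx); rewrite fr => -[e /= eb ex].
have [T [TM /imsetP[i _ ei] /imsetP[j _ ej] eT]] := edge_cell _ eb.
have [c [g E]] := interp_affine z _ TM.
have Ei := interp_node z T i TM; have Ej := interp_node z T j TM.
rewrite E in Ei; last exact: triangle_vertex.
rewrite E in Ej; last exact: triangle_vertex.
case: (ex) => t /= + tx; rewrite in_itv /= => /andP[t0 t1].
rewrite E; last exact: eT.
have xE : c + dot g x = (1 - t) * z e.1 + t * z e.2.
  rewrite ei ej -Ei -Ej -tx /seg_path dotDr dotZr dotBr /vertices -ei -ej; ring.
rewrite {}xE.
move: t0; rewrite le_eqVlt => /predU1P[t0|t0].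
  by rewrite -t0 mul0r addr0 zn ?mulr0 //; move: Dx;
    rewrite -tx -t0 /seg_path scale0r addr0.
move: t1; rewrite le_eqVlt => /predU1P[t1|t1].
  by rewrite t1 subrr mul0r add0r zn ?mulr0 //; move: Dx;
    rewrite -tx t1 /seg_path scale1r subrKC.
have [|oD] := bd _ eb; first by move=> /(ze _ eb)[-> ->]; rewrite !mulr0 addr0.
by exfalso; apply: (oD x) => //; exists t => //=; rewrite in_itv /= t0 t1.
Qed.

End interpolant.

(** The interpolant is continuous on the connected set [closure Omega] and takes only the values 0
    and 1. If both occurred, so would 1/2. *)
Lemma cellwise_constant_eq0 {R : realType} (M : mesh R) (Omega GammaD : set (R * R))
    (z : 'I_(nnodes M) -> R) x0 :
  conforming_triangulation M Omega GammaD -> connected Omega ->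
  (forall n, z n = 0 \/ z n = 1) ->
  (forall T i j, T \in cells M -> z (T i) = z (T j)) ->
  closure Omega x0 -> interp M z x0 = 0 ->
  forall T i, T \in cells M -> z (T i) = 0.
Proof.
move=> conf /connected_closure co z01 zc cx0 vx0 T i TM.
have v01 x : closure Omega x -> interp M z x = 0 \/ interp M z x = 1.
  move=> /(closure_cells _ _ _ conf)[T' T'M T'x].
  rewrite (interpE _ _ _ conf _ _ _ T'M T'x).
  under eq_bigr do rewrite (zc T' _ 0 T'M).
  rewrite -mulr_suml sum_bary ?mul1r //; exact: cell_nondeg conf _ T'M.
have /connected_intervalP itv :=
  connected_continuous_connected co (interp_continuous _ _ _ conf z).
have cTi : closure Omega (vertices T i).
  by apply: (triangle_closure _ _ _ conf _ TM); exact: triangle_vertex.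
have [//|zTi] := z01 (T i).
have [] : (interp M z @` closure Omega) 2^-1.
  apply: (itv 0 1); [by exists x0|exists (vertices T i)|]; last by lra.
    exact: cTi.
  by rewrite (interp_node _ _ _ conf).
by move=> x /v01[] -> ?; lra.
Qed.

(** * Integration *)

Section integral_setD_null.
Context d (T : measurableType d) {R : realType}.
Variable mu : {measure set T -> \bar R}.
Local Open Scope ereal_scope.
Import HBNNSimple.

(** The integral is a supremum over simple functions below [f] on [D]. Cutting such a function off
    on [N] keeps its integral and makes it admissible for the smaller domain. *)
Let ge0_integral_setD_null (D N : set T) (f : T -> \bar R) :
  measurable N -> mu N = 0 -> (forall x, 0 <= f x) ->
  \int[mu]_(x in D) f x = \int[mu]_(x in D `\` N) f x.
Proof.
move=> mN N0 f0; rewrite !ge0_integralE //.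
apply/eqP; rewrite eq_le; apply/andP; split.
  apply: ge_ereal_sup => _ [h /= hf <-]; apply: ereal_sup_ubound.
  have mNC : measurable (~` N) by exact: measurableC.
  have pE x : proj_nnsfun h mNC x = (h \_ (~` N)) x by rewrite mrestrict.
  exists (proj_nnsfun h mNC).
    move=> x; rewrite pE /patch; case: ifPn => xN.
      apply: le_trans (hf x) _; rewrite /patch; case: ifPn => [/set_mem Dx|_].
        by rewrite ifT //; apply/mem_set; split => //; exact: (set_mem xN).
      by case: ifP.
    by case: ifP.
  rewrite -!integralT_nnsfun.
  rewrite (ge0_negligible_integral mN) //; last 2 first.
  - by apply/measurable_EFinP; exact: measurable_funPT.
  - by move=> x _; rewrite lee_fin.
  rewrite [RHS](ge0_negligible_integral mN) //; last 2 first.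
  - by apply/measurable_EFinP; exact: measurable_funPT.
  - by move=> x _; rewrite lee_fin.
  apply: eq_integral => x /set_mem[_ Nx]; rewrite pE /patch ifT //.
  exact/mem_set.
apply: ge_ereal_sup => _ [h /= hf <-]; apply: ereal_sup_ubound.
exists h => //= x; apply: le_trans (hf x) _; rewrite /patch.
case: ifPn => [/set_mem[Dx _]|_]; first by rewrite ifT //; exact/mem_set.
by case: ifP.
Qed.

(** For a non-measurable [f] both sides are differences of lower integrals. *)
Lemma integral_setD_null (D N : set T) (f : T -> \bar R) :
  measurable N -> mu N = 0 ->
  \int[mu]_(x in D) f x = \int[mu]_(x in D `\` N) f x.
Proof.
move=> mN N0; rewrite integralE [RHS]integralE.
by congr (_ - _); apply: ge0_integral_setD_null.
Qed.
End integral_setD_null.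

(** * Lebesgue measure of boxes, open sets and lines in the plane *)

Section lebesgue_plane.
Context {R : realType}.
Local Notation R2 := (measurableTypeR R * measurableTypeR R)%type.
Implicit Types (A : set (R * R)).

Definition box (a b c d : R) : set (R * R) := `]a, b[%classic `*` `]c, d[%classic.

Lemma lebesgue2X (A B : set (measurableTypeR R)) : measurable A -> measurable B ->
  lebesgue2 R (A `*` B) = (lebesgue_measure A * lebesgue_measure B)%E.
Proof. exact: product_measure1E. Qed.

Lemma measurable_box (a b c d : R) : measurable (box a b c d : set R2).
Proof. by apply: measurableX; exact: measurable_itv. Qed.

Lemma lebesgue2_box (a b c d : R) : a < b -> c < d ->
  lebesgue2 R (box a b c d) = ((b - a) * (d - c))%:E.
Proof.
move=> ab cd; rewrite lebesgue2X; try exact: measurable_itv.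
by rewrite !lebesgue_measure_itv /= !lte_fin ab cd -!EFinB -EFinM.
Qed.

Lemma open_box A x : open A -> A x -> exists2 e : R, 0 < e &
  box (x.1 - e) (x.1 + e) (x.2 - e) (x.2 + e) `<=` A.
Proof.
move=> oA Ax; have /nbhs_ballP[e /= e0 eA] : nbhs x A by exact: open_nbhs_nbhs.
exists e => // y [/= y1 y2]; apply: eA; split => /=.
  by move: y1; rewrite in_itv /= -ball_normE /= ltr_distlC.
by move: y2; rewrite in_itv /= -ball_normE /= ltr_distlC.
Qed.

(** An open set is the union of the countably many boxes with rational corners that it contains, and
    boxes are measurable rectangles. *)
Lemma open_measurable2 A : open A -> measurable (A : set R2).
Proof.
move=> oA; pose B (q : (rat * rat) * (rat * rat)) : set (R * R) :=
  box (ratr q.1.1) (ratr q.1.2) (ratr q.2.1) (ratr q.2.2).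
pose F q : set R2 := if `[< B q `<=` A >] then B q else set0.
have -> : (A : set R2) = \bigcup_q F q.
  apply/seteqP; split => [x Ax|x [q _]]; last first.
    by rewrite /F; case: asboolP => // BA /BA.
  have [e e0 eA] := open_box _ _ oA Ax.
  have ratl (y : R) : exists q : rat, y - e < ratr q < y.
    have [|q] := @rat_in_itvoo R (y - e) y; first by rewrite ltrBlDr ltrDl.
    by rewrite in_itv /=; exists q.
  have ratu (y : R) : exists q : rat, y < ratr q < y + e.
    have [|q] := @rat_in_itvoo R y (y + e); first by rewrite ltrDl.
    by rewrite in_itv /=; exists q.
  have [a /andP[a1 a2]] := ratl x.1; have [b /andP[b1 b2]] := ratu x.1.
  have [c /andP[c1 c2]] := ratl x.2; have [d /andP[d1 d2]] := ratu x.2.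
  exists ((a, b), (c, d)) => //; rewrite /F; case: asboolP => [_|[]].
    by split => /=; rewrite in_itv /=; apply/andP.
  move=> y [/=]; rewrite !in_itv /= => /andP[y1 y2] /andP[y3 y4]; apply: eA.
  by split => /=; rewrite in_itv /=; apply/andP; split; lra.
apply: countable_bigcupT_measurable; first exact: countableP.
by move=> q; rewrite /F; case: asboolP => // _; exact: measurable_box.
Qed.

Lemma lebesgue2_open_gt0 A : open A -> A !=set0 -> (0 < lebesgue2 R A)%E.
Proof.
move=> oA [x Ax]; have [e e0 eA] := open_box _ _ oA Ax.
apply: (@lt_le_trans _ _
    (lebesgue2 R (box (x.1 - e) (x.1 + e) (x.2 - e) (x.2 + e)))).
  by rewrite lebesgue2_box ?lte_fin ?mulr_gt0 //; lra.
by apply: le_measure => //; rewrite inE;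
  [exact: measurable_box|exact: open_measurable2].
Qed.

Lemma lebesgue2_bounded_lty A : open A -> bounded_set A -> (lebesgue2 R A < +oo)%E.
Proof.
move=> oA [m [_ mA]]; have {mA} mA := mA (m + 1).
(* The max norm on [Omega] is at most any number above [m], here [m + 1]; the second 1 gives room
   for an open box. *)
pose K : R := m + 1 + 1.
apply: (@le_lt_trans _ _ (lebesgue2 R (box (- `|K|) `|K| (- `|K|) `|K|))).
  apply: le_measure; rewrite ?inE; [exact: open_measurable2|exact: measurable_box|].
  move=> x /mA; rewrite ltrDl ltr01 => /(_ isT).
  rewrite /= /Num.norm /= ge_max => /andP[x1 x2].
  have K1 : m + 1 < `|K| by apply: lt_le_trans (ler_norm _); rewrite ltrDl.
  by split => /=; rewrite in_itv /= -ltr_norml; apply: le_lt_trans K1.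
have [K0|K0] := ltP (- `|K|) `|K|; first by rewrite lebesgue2_box // ltry.
rewrite (_ : box _ _ _ _ = set0) ?measure0 //.
by rewrite -subset0 => y [/=]; rewrite in_itv /=; lra.
Qed.

(** A vertical line is a product with a one-point factor; any other line has one-point vertical
    sections. *)
Lemma lebesgue2_line (c : R) (g : R * R) : g != 0 ->
  lebesgue2 R [set x | c + dot g x = 0] = 0%E.
Proof.
move=> g0; have [g2|g2] := eqVneq g.2 0.
  have g1 : g.1 != 0.
    by apply: contraNneq g0 => g1; rewrite [g]surjective_pairing g1 g2.
  have -> : [set x | c + dot g x = 0] = [set - c / g.1] `*` setT.
    apply/seteqP; split => x /=; rewrite /dot g2 mul0r addr0 => h.
      by split => //; apply: (mulIf g1); rewrite divfK //; lra.
    by case: h => -> _; rewrite mulrC divfK // subrr.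
  by rewrite lebesgue2X // lebesgue_measure_set1 mul0e.
rewrite /lebesgue2 /= /product_measure1; apply: integral0_eq => x _ /=.
rewrite (_ : xsection _ x = [set - (c + g.1 * x) / g.2]) ?lebesgue_measure_set1 //.
apply/seteqP; split => y; rewrite /xsection /= ?inE /= /dot /=.
  by move=> h; apply: (mulIf g2); rewrite divfK //; lra.
by move=> ->; field.
Qed.

End lebesgue_plane.

(** * Measurability of compositions, null sets and vanishing integrals *)

Section measure_lemmas.
Context d (T : measurableType d) {R : realType}.
Variable mu : {measure set T -> \bar R}.

(** For a Lipschitz [K x], [K x s < r] iff [K x q + L * `|s - q| < r] for some
    rational [q]. *)
Lemma measurable_lipschitz_comp (D : set T) (K : T -> R -> R) (L : R) (w : T -> R) :
  0 < L -> (forall q : rat, measurable_fun D (fun x => K x (ratr q))) ->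
  (forall x, D x -> forall s t, `|K x s - K x t| <= L * `|s - t|) ->
  measurable_fun D w -> measurable_fun D (fun x => K x (w x)).
Proof.
move=> L0 mK lip mw mD; apply: (measurability _ (RGenInftyO.measurableE R)) => //.
move=> _ [_ [r ->] <-].
rewrite (_ : _ `&` _ = \bigcup_(q : rat)
    (D `&` (fun x => K x (ratr q) + L * `|w x - ratr q|) @^-1` `]-oo, r[)).
  apply: bigcupT_measurable_rat => q.
  apply: (_ : measurable_fun D _) => //.
  apply: measurable_funD => //; apply: measurable_funM; first exact: measurable_cst.
  by apply: measurableT_comp => //; apply: measurable_funB => //;
    exact: measurable_cst.
apply/seteqP; split => [x [Dx] /=|x [q _ [Dx]] /=].
  rewrite in_itv /= => Kr.
  (* Replacing [w x] by [q] costs at most [L * |w x - q|], and the penalty term costs the same; each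
     stays below half of the available gap. *)
  pose e := (r - K x (w x)) / (2 * L).
  have e0 : 0 < e by rewrite divr_gt0 ?mulr_gt0 // subr_gt0.
  have [|q] := @rat_in_itvoo R (w x - e) (w x + e); first by lra.
  rewrite in_itv /= -ltr_distlC => qe.
  exists q => //; split => //=; rewrite in_itv /=.
  have := lip _ Dx (ratr q) (w x); rewrite ler_norml => /andP[_].
  rewrite distrC in qe; rewrite (distrC (w x)).
  have : L * `|ratr q - w x| < (r - K x (w x)) / 2.
    rewrite (_ : _ / 2 = L * e) ?ltr_pM2l //.
    by rewrite /e; field; rewrite gt_eqF.
  by move: (L * _) => X; lra.
rewrite !in_itv /= => Kr; split => //.
by have := lip _ Dx (w x) (ratr q); rewrite ler_norml => /andP[_]; lra.
Qed.

Lemma Rintegral_eq0_null (D E : set T) (h : T -> R) :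
  measurable D -> measurable E -> mu.-integrable D (EFin \o h) ->
  (forall x, D x -> 0 <= h x) -> \int[mu]_(x in D) h x = 0 ->
  E `<=` D -> (forall x, E x -> 0 < h x) -> mu E = 0%E.
Proof.
move=> mD mE ih h0 int0 ED hE.
have mh : measurable_fun D (EFin \o h) := measurable_int _ ih.
have : (\int[mu]_(x in D) `|(EFin \o h) x| = 0)%E.
  rewrite -[RHS]/(0%:E) -int0 /Rintegral fineK ?integrable_fin_num //.
  by apply: eq_integral => x /set_mem Dx; rewrite gee0_abs // lee_fin h0.
move=> /(ae_eq_integral_abs _ mD mh) ae0.
apply: measure_negligible => //; apply: negligibleS ae0.
move=> x Ex /= /(_ (ED _ Ex)) [hx].
by have := hE _ Ex; rewrite hx ltxx.
Qed.

Lemma Rintegral_setD_null (D N : set T) (f : T -> R) :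
  measurable N -> mu N = 0%E ->
  \int[mu]_(x in D) f x = \int[mu]_(x in D `\` N) f x.
Proof. by move=> mN N0; rewrite /Rintegral (integral_setD_null _ _ mu D N). Qed.

Lemma measure0_setU (A B : set T) : measurable A -> measurable B ->
  mu A = 0%E -> mu B = 0%E -> mu (A `|` B) = 0%E.
Proof.
move=> mA mB A0 B0; apply/eqP; rewrite -measure_le0.
apply: (@le_trans _ _ (mu A + mu B)%E); first exact: measureU2.
by rewrite A0 B0 adde0.
Qed.

Lemma ae_null_set (P : T -> Prop) : {ae mu, forall x, P x} ->
  exists N, [/\ measurable N, mu N = 0%E & forall x, ~ N x -> P x].
Proof.
move=> [N [mN N0 PN]]; exists N; split => // x Nx.
by apply: contrapT => nP; exact/Nx/PN.
Qed.

Lemma ae_imp (P Q : T -> Prop) : (forall x, P x -> Q x) ->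
  {ae mu, forall x, P x} -> {ae mu, forall x, Q x}.
Proof. by move=> PQ; apply: filterS => x; exact: PQ. Qed.

Lemma ae_and (P Q : T -> Prop) :
  {ae mu, forall x, P x} -> {ae mu, forall x, Q x} ->
  {ae mu, forall x, P x /\ Q x}.
Proof. exact: filterI. Qed.

Lemma ae_countable_forall (I : countType) (P : I -> T -> Prop) :
  (forall i, {ae mu, forall x, P i x}) -> {ae mu, forall x, forall i, P i x}.
Proof.
move=> aeP; have : {ae mu, forall x, forall n : nat,
    if unpickle n is Some i then P i x else True}.
  apply: ae_foralln => n; case: (unpickle n) => [i|]; first exact: aeP.
  exact: aeW.
by apply: ae_imp => x Px i; have := Px (pickle i); rewrite pickleK.
Qed.

End measure_lemmas.

(** * Comparison at the nodes *)

Lemma measurable_fun_fin_cover d d' (T : measurableType d) (T' : measurableType d')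
    (I : finType) (D : set T) (U : I -> set T) (f : T -> T') :
  D `<=` \bigcup_i U i -> (forall i, measurable (D `&` U i)) ->
  (forall i, measurable_fun (D `&` U i) f) -> measurable_fun D f.
Proof.
move=> DU mU mf _ B mB.
rewrite (_ : _ `&` _ = \bigcup_i ((D `&` U i) `&` f @^-1` B)).
  apply: fin_bigcup_measurable => // i _; exact: mf.
apply/seteqP; split => [x [Dx fx]|x [i _ [[Dx _] fx]]] //.
by have [i _ Ux] := DU _ Dx; exists i.
Qed.

Section comparison.
Context {R : realType} (M : mesh R) (Omega GammaD : set (R * R)).
Local Notation R2 := (measurableTypeR R * measurableTypeR R)%type.
Hypothesis conf : conforming_triangulation M Omega GammaD.

Lemma measurable_affine (A : set R2) (c : R) (g : R * R) :
  measurable_fun A (fun x : R2 => c + dot g x).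
Proof.
apply: measurable_funTS; apply: measurable_funD; first exact: measurable_cst.
apply: measurable_funD; apply: measurable_funM; try exact: measurable_cst.
  exact: measurable_fst.
exact: measurable_snd.
Qed.

(** A point of a triangle outside its interior has a zero coordinate, so it lies on one of finitely
    many lines. *)
Lemma ae_cell_interior : {ae lebesgue2 R, forall x, Omega x ->
  exists2 T, T \in cells M & cell_interior M T x}.
Proof.
have bary_neq0 T i : T \in cells M ->
    {ae lebesgue2 R, forall x, bary (vertices T) i x <> 0}.
  move=> TM; have [c [g [g0 E]]] := bary_affine _ (cell_nondeg _ _ _ conf _ TM) i.
  exists [set x | c + dot g x = 0]; split; last by move=> x /= /contrapT; rewrite E.
    have -> : [set x | c + dot g x = 0] = setT `&`
        (fun x : R2 => c + dot g x) @^-1` [set 0] by rewrite setTI.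
    exact: measurable_affine.
  exact: lebesgue2_line.
have : {ae lebesgue2 R, forall x, forall T i, T \in cells M ->
    bary (vertices T) i x <> 0}.
  apply: ae_countable_forall => T; apply: ae_countable_forall => i.
  have [TM|TM] := boolP (T \in cells M); last first.
    by apply: aeW => x.
  by apply: ae_imp (bary_neq0 T i TM) => x.
apply: ae_imp => x nx Ox.
have [T TM Tx] := closure_cells _ _ _ conf _ (subset_closure Ox).
exists T => // i; rewrite lt_neqAle eq_sym; apply/andP; split.
  by apply/eqP; exact: nx.
exact: (triangleP _ _ _ (cell_nondegenerate _ _ _ conf _ TM)).1 Tx i.
Qed.

Lemma V0D_cell (y : R * R -> R) T : V0D M Omega GammaD y -> T \in cells M ->
  exists (c : R) (g : R * R), [/\ forall x, triangle T x -> y x = c + dot g x,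
    forall k, y (vertices T k) = c + dot g (vertices T k) &
    forall x, cell_interior M T x -> grad y x = g].
Proof.
move=> [_ yaff _] TM; have [c [g E]] := yaff _ TM; exists c, g; split => //.
  by move=> k; apply: E; exact: triangle_vertex.
by move=> x; exact: grad_cell conf _ _ _ _ _ TM E.
Qed.

(** On a triangle [w - u] is the convex combination of its vertex values with the barycentric
    weights. *)
Lemma V0D_convex_bound (u w : R * R -> R) T x m :
  V0D M Omega GammaD u -> V0D M Omega GammaD w ->
  T \in cells M -> triangle T x ->
  (forall k, `|w (vertices T k) - u (vertices T k)| <= m) ->
  `|w x - u x| <= m.
Proof.
move=> uV wV TM Tx h; have nd := cell_nondeg _ _ _ conf _ TM.
have [cu [gu [Eu ua _]]] := V0D_cell _ _ uV TM.
have [cw [gw [Ew wa _]]] := V0D_cell _ _ wV TM.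
have -> : w x - u x = \sum_i bary (vertices T) i x *
    (w (vertices T i) - u (vertices T i)).
  rewrite Ew // Eu // !(affine_bary _ nd _ _ x) -sumrB; apply: eq_bigr => i _.
  by rewrite mulrBr ua wa.
have b0 := (triangleP _ _ _ (cell_nondegenerate _ _ _ conf _ TM)).1 Tx.
apply: le_trans (ler_norm_sum _ _ _) _.
rewrite -[m]mul1r -(sum_bary _ nd x) mulr_suml; apply: ler_sum => i _.
by rewrite normrM ger0_norm // ler_wpM2l.
Qed.

Section integrands.
Variables (kappa : R * R -> R -> R) (kbeta L0 : R) (D : set R2).
Hypothesis mD : measurable D.
Hypothesis D_cells :
  forall x, D x -> exists2 T, T \in cells M & cell_interior M T x.
Hypothesis L0_gt0 : 0 < L0.
Hypothesis kappa_le : forall x, D x -> forall s, `|kappa x s| <= kbeta.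
Hypothesis kappa_lip :
  forall x, D x -> forall s t, `|kappa x s - kappa x t| <= L0 * `|s - t|.
Hypothesis kappa_meas :
  forall q : rat, measurable_fun D (fun x => kappa x (ratr q)).

(** A bounded measurable function on a set of finite measure. On each cell the gradients are
    constant and [y] is affine, so measurability reduces to that of a Lipschitz coefficient composed
    with an affine function. *)
Lemma integrable_flux (y v : R * R -> R) : (lebesgue2 R D < +oo)%E ->
  V0D M Omega GammaD y -> V0D M Omega GammaD v ->
  (lebesgue2 R).-integrable D
    (EFin \o (fun x => kappa x (y x) * dot (grad y x) (grad v x))).
Proof.
move=> Dfin yV vV.
have /choice[dT dTE] T : exists d : R, T \in cells M ->
    forall x, cell_interior M T x -> dot (grad y x) (grad v x) = d.
  have [TM|TM] := boolP (T \in cells M); last by exists 0.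
  have [_ [gy [_ _ Ey]]] := V0D_cell _ _ yV TM.
  have [_ [gv [_ _ Ev]]] := V0D_cell _ _ vV TM.
  by exists (dot gy gv) => _ x xT; rewrite Ey ?Ev.
apply: measurable_bounded_integrable => //; last first.
  (* The sum over all cells serves as a bound for each single one. *)
  exists (kbeta * \sum_T `|dT T|); split; first exact: num_real.
  move=> K KT x Dx; have [T TM xT] := D_cells _ Dx.
  rewrite /= (dTE _ TM _ xT) normrM; apply: le_trans (ltW KT).
  apply: ler_pM => //; first exact: kappa_le.
  by rewrite (bigD1 T) //= lerDl sumr_ge0.
pose U T : set R2 := if T \in cells M then cell_interior M T else set0.
have mU T : measurable (D `&` U T).
  apply: measurableI => //; rewrite /U; case: ifP => // TM.
  by apply: open_measurable2; exact: open_cell_interior conf _ TM.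
apply: (@measurable_fun_fin_cover _ _ _ _ _ D U) => //.
  by move=> x /D_cells[T TM xT]; exists T => //; rewrite /U TM.
move=> T; rewrite /U; case: ifP => TM; last first.
  by rewrite setI0; exact: measurable_fun_set0.
have [c [g [E _ _]]] := V0D_cell _ _ yV TM.
apply: (eq_measurable_fun (fun x : R2 => kappa x (c + dot g x) * dT T)).
  move=> x /set_mem[_ xT]; rewrite (dTE _ TM _ xT) E //.
  exact: cell_interior_sub conf _ TM _ xT.
apply: measurable_funM; last exact: measurable_cst.
apply: (@measurable_lipschitz_comp _ R2 R (D `&` cell_interior M T) kappa L0
  (fun x => c + dot g x)) => //.
- by move=> q; apply: measurable_funS (kappa_meas q) => // x [].
- by move=> x [Dx _]; exact: kappa_lip.
- exact: measurable_affine.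
Qed.

End integrands.

End comparison.

(** A countable union of null sets is null, so one exceptional set serves all [i]; the family will
    be the coefficient at rational arguments. *)
Lemma ae_measurable_family d (T : measurableType d) (R : realType)
    (mu : {measure set T -> \bar R}) (D : set T) (I : countType)
    (F : I -> T -> R) : (forall i, ae_measurable mu D (F i)) ->
  exists N, [/\ measurable N, mu N = 0%E &
    forall i, measurable D -> measurable_fun (D `\` N) (F i)].
Proof.
move=> aeF; have /choice[G GE] i : exists g : T -> R,
    measurable_fun D g /\ {ae mu, forall x, D x -> F i x = g x}.
  by have [g mg E] := aeF i; exists g.
have [N [mN N0 NE]] := ae_null_set _ _ _ _
  (ae_countable_forall _ _ mu _ _ (fun i => (GE i).2)).
exists N; split => // i mD.
apply: (eq_measurable_fun (G i)).
  by move=> x /set_mem[Dx Nx]; rewrite NE.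
by apply: measurable_funS (GE i).1 => // x [].
Qed.

(** * From equality of the integrated fluxes to inequalities at the nodes *)

Section nodal_comparison.
Context {R : realType} (M : mesh R) (Omega GammaD : set (R * R)).
Local Notation R2 := (measurableTypeR R * measurableTypeR R)%type.
Variables (kalpha kbeta L0 : R) (kappa : R * R -> R -> R) (u w : R * R -> R).
Hypothesis conf : conforming_triangulation M Omega GammaD.
Hypothesis Omega_open : open Omega.
Hypothesis Omega_connected : connected Omega.
Hypothesis Omega_bounded : bounded_set Omega.
Hypothesis GammaD_sub : GammaD `<=` frontier Omega.
Hypothesis GammaD_neq0 : GammaD !=set0.
Hypothesis kappa_meas :
  forall s, ae_measurable (lebesgue2 R) Omega (fun x => kappa x s).
Hypothesis kalpha_gt0 : 0 < kalpha.
Hypothesis kappa_bounds : {ae lebesgue2 R, forall x, Omega x ->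
  forall s : R, kalpha < kappa x s < kbeta}.
Hypothesis L0_gt0 : 0 < L0.
Hypothesis kappa_lip : {ae lebesgue2 R, forall x, Omega x ->
  forall s t : R, `|kappa x s - kappa x t| <= L0 * `|s - t|}.
Hypothesis uV : V0D M Omega GammaD u.
Hypothesis wV : V0D M Omega GammaD w.
Hypothesis u_small : forall T, T \in cells M ->
  (gammaT (vertices T))^-1 * (1 + (gammaT (vertices T))^-1) * oscT (vertices T) u
    < 6 * kalpha * cT (vertices T) / (7 * L0).
Hypothesis flux_eq : forall v, V0D M Omega GammaD v ->
  \int[lebesgue2 R]_(x in Omega) (kappa x (w x) * dot (grad w x) (grad v x)) =
  \int[lebesgue2 R]_(x in Omega) (kappa x (u x) * dot (grad u x) (grad v x)).

Let ind (t : R) (n : 'I_(nnodes M)) : R :=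
  (0 < t * (w (node M n) - u (node M n)))%R%:R.

(** Both [u] and [w] vanish at the Dirichlet nodes, where the strict inequality in [ind] therefore
    fails. *)
Let ind_V0D t : V0D M Omega GammaD (interp M (ind t)).
Proof.
have ind0 n : w (node M n) = 0 -> u (node M n) = 0 -> ind t n = 0.
  by move=> w0 u0; rewrite /ind w0 u0 subrr mulr0 ltxx.
apply: (interp_V0D _ _ _ conf) => //; [move=> n nD|move=> e eb eD].
  by apply: ind0; [case: wV => _ _ h|case: uV => _ _ h]; exact: h.
have [w1 w2] := V0D_boundary_node _ _ _ _ _ wV eb eD.
have [u1 u2] := V0D_boundary_node _ _ _ _ _ uV eb eD.
by split; exact: ind0.
Qed.

Let flux_gap (t : R) T x : `|t| = 1 -> T \in cells M -> cell_interior M T x ->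
  (forall s, kalpha < kappa x s) ->
  (forall r s, `|kappa x r - kappa x s| <= L0 * `|r - s|) ->
  let v := interp M (ind t) in
  let gap := t * (kappa x (w x) * dot (grad w x) (grad v x) -
                  kappa x (u x) * dot (grad u x) (grad v x)) in
  (forall i j, ind t (T i) = ind t (T j)) /\ gap = 0 \/ 0 < gap.
Proof.
move=> t1 TM xT kge klip v gap.
have nd := cell_nondeg _ _ _ conf _ TM.
have [cu [gu [_ ua Eu]]] := V0D_cell _ _ _ conf _ _ uV TM.
have [cw [gw [_ wa Ew]]] := V0D_cell _ _ _ conf _ _ wV TM.
have [cv [h [_ va Ev]]] := V0D_cell _ _ _ conf _ _ (ind_V0D t) TM.
have vE k : interp M (ind t) (vertices T k) = ind t (T k).
  exact: interp_node conf _ _ _ TM.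
rewrite /gap Eu // Ew // Ev //.
have [cst|/existsNP[i /existsNP[j ij]]] :=
    pselect (forall i j, ind t (T i) = ind t (T j)).
  left; split => //; rewrite (grad_eq0 _ nd cv h); last first.
    by move=> i j; rewrite -!va !vE.
  by rewrite /dot /= !(mulr0, addr0) subrr mulr0.
right; apply: (mixed_cell_gap (vertices T) kalpha L0 t _ _ `|w x - u x|
  u w (interp M (ind t))
  cu cw cv gu gw h i j) => //; first exact: u_small.
- by rewrite !vE; apply/eqP.
- move=> m; apply: (V0D_convex_bound _ _ _ conf _ _ _ _ _ uV wV TM).
  exact: cell_interior_sub conf _ TM _ xT.
Qed.

Lemma nodal_comparison t T i : `|t| = 1 -> T \in cells M ->
  t * (w (vertices T i) - u (vertices T i)) <= 0.
Proof.
move=> t1 TM; pose v := interp M (ind t).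
have mO : measurable (Omega : set R2) := open_measurable2 _ Omega_open.
have [N1 [mN1 N10 kN1]] := ae_measurable_family _ _ _ (lebesgue2 R) Omega rat
  (fun q x => kappa x (ratr q)) (fun q => kappa_meas (ratr q)).
have [N2 [mN2 N20 NE]] := ae_null_set _ _ _ _
  (ae_and _ _ _ _ _ (ae_cell_interior _ _ _ conf)
    (ae_and _ _ _ _ _ kappa_bounds kappa_lip)).
have mN : measurable (N1 `|` N2 : set R2) by exact: measurableU.
have N0 : lebesgue2 R (N1 `|` N2) = 0%E.
  exact: (measure0_setU _ R2 (lebesgue2 R)).
(* On [D] the bounds, the Lipschitz estimate and membership in an open cell hold at every point, and
   [Omega] loses only a null set. *)
pose D : set R2 := Omega `\` (N1 `|` N2).
have mD : measurable D by exact: measurableD.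
have Dgood x : D x -> [/\ exists2 T, T \in cells M & cell_interior M T x,
    forall s, kalpha < kappa x s < kbeta &
    forall r s, `|kappa x r - kappa x s| <= L0 * `|r - s|].
  move=> [Ox /not_orP[_ N2x]].
  have /= [c [b l]] := NE x N2x.
  by split; [exact: c|exact: b|exact: l].
have D_cells x : D x -> exists2 T, T \in cells M & cell_interior M T x.
  by move=> /Dgood[].
have Dle x : D x -> forall s, `|kappa x s| <= kbeta.
  move=> /Dgood[_ b _] s; have /andP[b1 b2] := b s.
  by rewrite ger0_norm ?ltW // (lt_trans kalpha_gt0).
have Dlip x : D x -> forall r s, `|kappa x r - kappa x s| <= L0 * `|r - s|.
  by move=> /Dgood[].
have Dmeas (q : rat) : measurable_fun D (fun x : R2 => kappa x (ratr q)).
  apply: measurable_funS (kN1 q mO); first exact: measurableD.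
  by move=> x [Ox /not_orP[N1x _]].
have Dfin : (lebesgue2 R D < +oo)%E.
  apply: le_lt_trans (lebesgue2_bounded_lty _ Omega_open Omega_bounded).
  by apply: le_measure; rewrite ?inE // => x [].
pose flux y x := kappa x (y x) * dot (grad y x) (grad v x).
have int_flux y : V0D M Omega GammaD y ->
    (lebesgue2 R).-integrable D (EFin \o flux y).
  move=> yV; exact: (integrable_flux _ _ _ conf _ _ _ _ mD D_cells L0_gt0 Dle
    Dlip Dmeas _ _ Dfin yV (ind_V0D t)).
pose gap x := t * (flux w x - flux u x).
have igap0 : (lebesgue2 R).-integrable D (EFin \o (flux w \- flux u)).
  exact: (integrableB mD (int_flux w wV) (int_flux u uV)).
have igap : (lebesgue2 R).-integrable D (EFin \o gap).
  exact: (integrableZl mD t igap0).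
have gap0 : \int[lebesgue2 R]_(x in D) gap x = 0.
  rewrite /gap RintegralZl // RintegralB ?int_flux //.
  rewrite -!(Rintegral_setD_null _ R2 (lebesgue2 R) Omega _ _ mN N0).
  by rewrite (flux_eq _ (ind_V0D t)) subrr mulr0.
have gapE T' x : T' \in cells M -> D x -> cell_interior M T' x ->
    (forall i j, ind t (T' i) = ind t (T' j)) /\ gap x = 0 \/ 0 < gap x.
  move=> T'M Dx xT'; apply: (flux_gap t T' x t1 T'M xT'); last exact: Dlip.
  by move=> s; have [_ /(_ s)/andP[]] := Dgood _ Dx.
have gap_ge0 x : D x -> 0 <= gap x.
  move=> Dx; have [T' T'M xT'] := D_cells _ Dx.
  by have [[_ ->]|/ltW] := gapE _ _ T'M Dx xT'.
(* On a cell with mixed nodal values [gap] would be positive, so its part in [D] would be null. Up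
   to a null set that part is a nonempty open set, which has positive measure. *)
have ind_cst T' i' j' : T' \in cells M -> ind t (T' i') = ind t (T' j').
  move=> T'M; apply: contrapT => mixed.
  have oT' := open_cell_interior _ _ _ conf _ T'M.
  have mT' : measurable (cell_interior M T' : set R2) by exact: open_measurable2.
  have E0 : lebesgue2 R (D `&` cell_interior M T') = 0%E.
    apply: (Rintegral_eq0_null _ _ _ D _ gap) => //; first exact: measurableI.
    move=> x [Dx xT']; have [[cst _]|//] := gapE _ _ T'M Dx xT'.
    by exfalso; exact/mixed/cst.
  have : (0 < lebesgue2 R (Omega `&` cell_interior M T'))%E.
    apply: lebesgue2_open_gt0; first exact: openI.
    have [y yT'] := cell_interior_neq0 _ _ _ conf _ T'M.
    (* The triangle lies in the closure of [Omega], so its open interior meets [Omega] itself. *)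
    have := triangle_closure _ _ _ conf _ T'M _
      (cell_interior_sub _ _ _ conf _ T'M _ yT').
    move=> /(_ _ (open_nbhs_nbhs (conj oT' yT')))[x [Ox xT']].
    by exists x.
  apply/negP; rewrite -leNgt -(measure0_setU _ R2 (lebesgue2 R) _ _
    (measurableI _ _ mD mT') mN E0 N0).
  apply: le_measure; rewrite ?inE; [exact: measurableI| |].
    by apply: measurableU => //; exact: measurableI.
  move=> x [Ox xT']; have [Nx|Nx] := pselect ((N1 `|` N2) x); first by right.
  by left.
(* A Dirichlet point supplies the zero of the test function that excludes the constant 1. *)
have [x0 Dx0] := GammaD_neq0.
have := cellwise_constant_eq0 M Omega GammaD (ind t) x0 conf Omega_connected _
  ind_cst (GammaD_sub _ Dx0).1 _ T i TM.
rewrite /ind leNgt => h; apply/negP => pos.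
have /eqP : (0 < t * (w (node M (T i)) - u (node M (T i))))%R%:R = 0 :> R.
  apply: h => [n|]; first by case: (0 < _); [right|left].
  by case: (ind_V0D t) => _ _; exact.
by rewrite (pos : 0 < t * (w (node M (T i)) - u (node M (T i)))) oner_eq0.
Qed.

End nodal_comparison.

(** * Uniqueness from the nodal comparison with both signs *)

Theorem corollary3p5 (R : realType) (Omega GammaD : set (R * R)) (M : mesh R)
  (tmin tmax kalpha kbeta L0 : R) (kappa : R * R -> R -> R)
  (f psi u : R * R -> R)
  (Omega_polygonal : polygonal_domain Omega)
  (GammaD_sub : GammaD `<=` frontier Omega)
  (M_conforming : conforming_triangulation M Omega GammaD)
  (GammaD_gt0 : (0 < arc_length M Omega GammaD)%E)
  (tmin_gt0 : 0 < tmin) (tmin_lt_tmax : tmin < tmax) (tmax_lt : tmax < pi / 2)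
  (M_regular : forall T, T \in cells M -> forall i : 'I_3,
     tmin <= interior_angle (vertices T) i <= tmax)
  (kappa_caratheodory : caratheodory_fun Omega kappa)
  (kalpha_gt0 : 0 < kalpha) (kalpha_lt_kbeta : kalpha < kbeta)
  (kappa_bounds : {ae lebesgue2 R, forall x, Omega x ->
     forall s : R, kalpha < kappa x s < kbeta})
  (L0_gt0 : 0 < L0)
  (kappa_lipschitz : {ae lebesgue2 R, forall x, Omega x ->
     forall s t : R, `|kappa x s - kappa x t| <= L0 * `|s - t|})
  (f_L2 : square_integrable (lebesgue2 R) Omega f)
  (psi_H_half : H_half M Omega (frontier Omega `\` GammaD) psi)
  (u_solution : discrete_solution M Omega GammaD kappa f psi u)
  (u_small : forall T, T \in cells M ->
     let a := vertices T in
     (gammaT a)^-1 * (1 + (gammaT a)^-1) * oscT a u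
       < 6 * kalpha * cT a / (7 * L0)) :
  forall w : R * R -> R, discrete_solution M Omega GammaD kappa f psi w ->
  forall x, closure Omega x -> w x = u x.
Proof.
move=> w [wV wE]; case: u_solution => uV uE.
have [Oo Oc _ Ob _] := Omega_polygonal.
have [km _] := kappa_caratheodory.
have GammaD_neq0 : GammaD !=set0.
  apply/set0P/eqP => D0; move: GammaD_gt0; rewrite D0 measure0 ltxx //.
have cmp t T i : `|t| = 1 -> T \in cells M ->
    t * (w (vertices T i) - u (vertices T i)) <= 0.
  apply: (nodal_comparison M Omega GammaD kalpha kbeta L0 kappa u w M_conforming
    Oo Oc Ob GammaD_sub GammaD_neq0 km kalpha_gt0 kappa_bounds L0_gt0
    kappa_lipschitz uV wV u_small).
  by move=> v vV; rewrite (wE v vV) (uE v vV).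
move=> x Ox; have [T TM Tx] := closure_cells _ _ _ M_conforming _ Ox.
apply/eqP; rewrite -subr_eq0 -normr_le0.
(* With the bound [m = 0] it is enough that [w] and [u] agree at the vertices, which the signs 1 and
   -1 give together. *)
apply: (V0D_convex_bound _ _ _ M_conforming _ _ _ _ _ uV wV TM Tx) => k.
have := cmp 1 T k (normr1 _) TM; have := cmp (-1) T k (normrN1 _) TM.
rewrite mul1r mulN1r normr_le0 => h1 h2; apply/eqP; lra.
Qed.
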